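(* Let $R$ be an associative unital ring, let $n\geq 0$ be an integer, let $Free$ be the class of all free right $R$-modules, and let $\mathcal{P}_n$ be the class of all right $R$-modules of projective dimension $\leq n$. Let $\mathcal{M}$ be either the class of all embeddings, the class of all RD-embeddings, or the class of all pure embeddings of right $R$-modules. Then $(Free,\leq_{\mathcal{M}})$ and $(\mathcal{P}_n,\leq_{\mathcal{M}})$ are stable.
   Context: Modules are right $R$-modules; $\|M\|$ denotes the cardinality of a module $M$. An embedding is a monomorphism. A submodule $N$ of $M$ is an RD-submodule if $N\cap Mr=Nr$ for all $r\in R$; it is a pure submodule if every finite system of $R$-linear equations with right-hand side in $N$ that is solvable in $M$ is solvable in $N$. An RD-embedding (pure embedding) is a monomorphism whose image is an RD-submodule (pure submodule) of its codomain. Let $\mathcal{A}$ be a class of modules closed under isomorphism. For $A,B\in\mathcal{A}$, $A\leq_{\mathcal{M}}B$ means that $A$ is a submodule of $B$ and the inclusion is in $\mathcal{M}$. Write $\mathbf{A}=(\mathcal{A},\leq_{\mathcal{M}})$. An $\mathbf{A}$-embedding is a monomorphism $f:A\to B$ with $A,B\in\mathcal{A}$ and $f(A)\leq_{\mathcal{M}}B$. $\operatorname{LS}(\mathbf{A})$ is the least infinite cardinal $\lambda\geq\operatorname{card}(R)$ such that whenever $A$ is a submodule of $B\in\mathcal{A}$ there is $A'\in\mathcal{A}$ with $A\subseteq A'\leq_{\mathcal{M}}B$ and $\|A'\|\leq\|A\|+\lambda$. Galois types: consider triples $(\bar b,A,N)$ with $N\in\mathcal{A}$, $A$ a submodule of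 $N$, and $\bar b$ a (possibly infinite) tuple of elements of $N$. Triples $(\bar b_1,A_1,N_1),(\bar b_2,A_2,N_2)$ are atomically related if $A_1=A_2=:A$ and there are $N\in\mathcal{A}$ and $\mathbf{A}$-embeddings $f_i:N_i\to N$ ($i=1,2$) restricting to the identity on $A$ with $f_1(\bar b_1)=f_2(\bar b_2)$. Let $E^{\mathbf{A}}$ be the transitive closure of this relation; $\mathbf{gtp}_{\mathbf{A}}(\bar b/A;N)$ is the $E^{\mathbf{A}}$-class of $(\bar b,A,N)$. For $M\in\mathcal{A}$, $\mathbf{gS}_{\mathbf{A}}(M)=\{\mathbf{gtp}_{\mathbf{A}}(b/M;N)\mid M\leq_{\mathcal{M}}N\in\mathcal{A},\ b\in N\text{ a single element}\}$. $\mathbf{A}$ is stable in $\lambda$ if $|\mathbf{gS}_{\mathbf{A}}(M)|\leq\lambda$ for every $M\in\mathcal{A}$ with $\|M\|=\lambda$; $\mathbf{A}$ is stable if it is stable in $\lambda$ for some cardinal $\lambda\geq\operatorname{LS}(\mathbf{A})$. *)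

(* Defs.v *)
From Stdlib Require Import Relations.
From mathcomp Require Import all_boot all_algebra.
From mathcomp Require Import boolp classical_sets functions cardinality.

Set Implicit Arguments.
Unset Strict Implicit.
Unset Printing Implicit Defensive.

Import GRing.Theory.

Local Open Scope classical_set_scope.
Local Open Scope card_scope.
Local Open Scope ring_scope.

(* R^c is the opposite ring, so that a left R^c-module is a right R-module:
   for r : R^c, r *: x is what is written x r for right modules. *)
Notation rmod R := (lmodType R^c).

(* Cardinals are represented by types, compared by injections. *)
Definition cardinal := Type.

Definition module_card (R : pzRingType) (M : rmod R) : cardinal := M.

(* Pitfall: a type in a universe above that of modules would be larger than
   every module, and stability in it would be vacuous. This definition bounds
   the universe of cardinals by that of modules; with module_card, the two
   universes are equal. *)
Definition function_module (R : pzRingType) (X : cardinal) : rmod R :=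
  (X -> (R^c)^o)%type.

Section Submodules.
Variables (R : pzRingType) (M : rmod R).
Implicit Type N : set M.

Definition RD_subset N : Prop :=
  forall r : R^c, N `&` [set r *: x | x in [set: M]] = [set r *: x | x in N].

Definition system_solution (m k : nat) (a : 'I_m -> 'I_k -> R^c)
    (b : 'I_m -> M) (x : 'I_k -> M) : Prop :=
  forall i, \sum_(j < k) a i j *: x j = b i.

Definition pure_subset N : Prop :=
  forall (m k : nat) (a : 'I_m -> 'I_k -> R^c) (b : 'I_m -> M),
    (forall i, N (b i)) ->
    (exists x, system_solution a b x) ->
    exists2 x, (forall j, N (x j)) & system_solution a b x.

End Submodules.

(* Isomorphism-invariant classes of modules are predicates on modules. A
   submodule is given by an injective linear map; the submodule itself is the
   image of the map. *)
Definition module_class (R : pzRingType) := rmod R -> Prop.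
Definition morphism_class (R : pzRingType) :=
  forall A B : rmod R, {linear A -> B} -> Prop.

Definition embedding (R : pzRingType) : morphism_class R :=
  fun A B f => injective f.

Definition RD_embedding (R : pzRingType) : morphism_class R :=
  fun A B f => injective f /\ RD_subset (range f).

Definition pure_embedding (R : pzRingType) : morphism_class R :=
  fun A B f => injective f /\ pure_subset (range f).

Section ModuleClasses.
Variable R : pzRingType.

Definition is_basis (F : rmod R) (B : set F) : Prop :=
  (forall (s : seq F) (c : F -> R^c), uniq s -> (forall x, x \in s -> B x) ->
     \sum_(x <- s) c x *: x = 0 -> forall x, x \in s -> c x = 0) /\
  (forall y : F, exists (s : seq F) (c : F -> R^c),
     (forall x, x \in s -> B x) /\ y = \sum_(x <- s) c x *: x).

Definition free_class : module_class R :=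
  fun F => exists B : set F, is_basis B.

Definition projective (P : rmod R) : Prop :=
  forall (A B : rmod R) (g : {linear A -> B}) (f : {linear P -> B}),
    range g = setT -> exists h : {linear P -> A}, forall x, g (h x) = f x.

Definition kernel (A B : rmod R) (f : {linear A -> B}) : set A :=
  [set x | f x = 0].

(* There is a projective resolution
   ... --> 0 --> P n --> ... --> P 1 --> P 0 --> M --> 0. *)
Definition proj_dim_le (n : nat) : module_class R :=
  fun M => exists (P : nat -> rmod R) (d : forall i, {linear P i.+1 -> P i})
                  (e : {linear P 0%N -> M}),
    [/\ forall i, projective (P i),
        forall i, (n < i)%N -> forall x : P i, x = 0,
        range e = setT,
        range (d 0%N) = kernel e
      & forall i, range (d i.+1) = kernel (d i)].

End ModuleClasses.

Section Stability.
Variables (R : pzRingType) (K : module_class R) (M : morphism_class R).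

Definition K_embedding (A B : rmod R) (f : {linear A -> B}) : Prop :=
  [/\ K A, K B & M f].

(* As M consists of monomorphisms and is invariant under isomorphism, a
   K-embedding into B amounts to a submodule A' of B with A' <=_M B. *)
Definition LS_bound (l : cardinal) : Prop :=
  [/\ infinite_set [set: l],
      [set: R] #<= [set: l]
    & forall (A B : rmod R) (i : {linear A -> B}), injective i -> K B ->
        exists (A' : rmod R) (j : {linear A' -> B}),
          [/\ K_embedding j, range i `<=` range j
            & [set: module_card A'] #<= [set: (module_card A + l)%type]]].

Definition is_LS (l : cardinal) : Prop :=
  LS_bound l /\ forall l' : cardinal, LS_bound l' -> [set: l] #<= [set: l'].

(* Triples (b, A, N) with A and the index type I of the tuple b fixed: related
   triples share both. A is identified with its image in N. *)
Record triple (I : Type) (A : rmod R) := Triple {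
  ambient : rmod R;
  ambient_in : K ambient;
  incl : {linear A -> ambient};
  incl_inj : injective incl;
  tup : I -> ambient }.

Definition atomically_related (I : Type) (A : rmod R) :
    relation (triple I A) :=
  fun t1 t2 =>
    exists (N : rmod R) (f1 : {linear ambient t1 -> N})
           (f2 : {linear ambient t2 -> N}),
      [/\ K_embedding f1, K_embedding f2,
          forall a, f1 (incl t1 a) = f2 (incl t2 a)
        & forall i, f1 (tup t1 i) = f2 (tup t2 i)].

Definition gtp (I : Type) (A : rmod R) (t : triple I A) : triple I A -> Prop :=
  fun t' => clos_trans _ (@atomically_related I A) t t'.

(* Types of triples lie in a universe above that of modules, where the
   library's set and #<= do not apply; hence plain predicates here. *)
Definition gS (A : rmod R) : (triple unit A -> Prop) -> Prop :=
  fun p => exists2 t : triple unit A, K_embedding (incl t) & p = gtp t.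

Definition stable_in (l : cardinal) : Prop :=
  forall A : rmod R, K A -> [set: module_card A] #= [set: l] ->
    exists f : {p | @gS A p} -> l, injective f.

Definition stable : Prop :=
  exists LS l : cardinal, [/\ is_LS LS, [set: LS] #<= [set: l] & stable_in l].

End Stability.

(* Main.v *)
Require Import Defs.
From Stdlib Require Import Relations.
From HB Require Import structures.
From mathcomp Require Import all_boot all_algebra.
From mathcomp Require Import generic_quotient ring_quotient.
From mathcomp Require Import boolp classical_sets functions cardinality.

Set Implicit Arguments.
Unset Strict Implicit.
Unset Printing Implicit Defensive.

Import GRing.Theory.

Local Open Scope classical_set_scope.
Local Open Scope card_scope.
Local Open Scope ring_scope.

(** Let K be a class of modules closed under extensions, and mu an infinite
    cardinal, at least the cardinal of R. Call a submodule S of M clean if both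
    S and M / S belong to K. The theorem follows from three facts, valid for
    the free modules and for the modules of projective dimension at most n.

    Clean submodules abound (pd_hull, skolem_hull). Expand M in K by the elements
    of a projective resolution of M, each term with a dual basis. A subset of the
    expansion whose traces on the terms form an exact subcomplex, and contain the
    members of the dual bases that occur in their elements, has a clean trace on
    M: the traces are projective, so are the quotients by them, and these modules
    resolve S and M / S. The requirement is a conjunction of mu Skolem
    conditions, as purity and RD-purity are. Hence every subset Y lies in a clean
    pure submodule of size at most |Y| + mu, and LS is card R + aleph_0.

    Types are realised in small extensions (small_generation). Let A <= N in K
    and b in N. A closed set containing b, for the conditions of A and of N
    together, meets N in a clean N0 of size at most mu that contains b, and meets
    A in a clean A0 equal to the intersection of A and N0. The module
    N' = A + N0 belongs to K, being an extension of N0 by A / A0, although N / N'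
    may be out of K; and the conditions can make N' / A pure in N / A, so that N'
    is pure in N if A is. So (b, A, N) and (b, A, N') have the same type.
    This replaces amalgamation, which may fail in these classes.

    There are few such extensions (code_isomorphism). N' is the pushout of A and N0
    over A0. Given an enumeration of N0 by mu, it is determined over A by the
    partial function that sends a formal combination of the enumerated elements
    to its value, when this value is in A. If A has 2 ^ mu elements, which can
    then be named by subsets of mu, such a function and the place of b in the
    enumeration are coded by a subset of a set of size mu. Thus there are at
    most 2 ^ mu types over A, and K is stable in 2 ^ mu. *)

(** * Cardinals *)

Definition injects (X Y : Type) : Prop := exists f : X -> Y, injective f.

Lemma sval_inj (T : Type) (P : T -> Prop) : injective (@proj1_sig T P).
Proof. by move=> [x Px] [y Py] /= xy; exact: eq_exist. Qed.

Lemma card_leTP (X Y : Type) : [set: X] #<= [set: Y] <-> injects X Y.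
Proof.
split; last first.
  by move=> [f fI]; apply/card_leP/injfunPex; exists (to_setT \o f \o val) => //
    x y _ _ /= /(congr1 val)/fI/val_inj.
move=> /card_leP[f].
exists (fun x => val (f (to_setT x))) => x y /val_inj.
by move=> /(@inj _ _ _ f _ _ (in_setT _) (in_setT _)) /(congr1 val).
Qed.

Lemma injects_trans (X Y Z : Type) : injects X Y -> injects Y Z -> injects X Z.
Proof. by move=> [f fI] [g gI]; exists (g \o f); exact: inj_comp. Qed.

Lemma injects_rel (X Y : Type) (r : X -> Y -> Prop) :
  (forall x, exists y, r x y) -> (forall x x' y, r x y -> r x' y -> x = x') ->
  injects X Y.
Proof.
move=> /choice[f fP] rI; exists f => x x' e.
by apply: rI (fP x) _; rewrite e; exact: fP.
Qed.

Lemma injects_sum (X Y X' Y' : Type) :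
  injects X X' -> injects Y Y' -> injects (X + Y) (X' + Y').
Proof.
move=> [f fI] [g gI].
exists (fun z => match z with inl x => inl (f x) | inr y => inr (g y) end).
by case=> [x|x] [y|y] // -[] => [/fI|/gI] ->.
Qed.

Lemma injects_seq (X Y : Type) : injects X Y -> injects (seq X) (seq Y).
Proof. by move=> [f fI]; exists (map f); exact: inj_map. Qed.

(** A maximal partial bijection between X and Y is total on one side, since
    otherwise one more pair can be added to it. *)
Lemma injects_total (X Y : Type) : injects X Y \/ injects Y X.
Proof.
pose P (G : set (X * Y)) := forall p q, G p -> G q -> (p.1 = q.1 <-> p.2 = q.2).
have [|G [PG Gmax]] := @Zorn_bigcup _ P.
  move=> F FP Ftot p q [G FG Gp] [H FH Hq].
  have [GH|HG] := Ftot _ _ FG FH.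
    exact: (FP _ FH) (GH _ Gp) Hq.
  exact: (FP _ FG) Gp (HG _ Hq).
have [xdom|] := pselect (forall x, exists y, G (x, y)).
  have [f fG] := choice xdom; left; exists f => x x' fxx'.
  exact: (PG _ _ (fG x) (fG x')).2.
move=> /existsNP[x xG].
have [ydom|] := pselect (forall y, exists x, G (x, y)).
  have [f fG] := choice ydom; right; exists f => y y' fyy'.
  exact: (PG _ _ (fG y) (fG y')).1.
move=> /existsNP[y yG]; exfalso.
apply: (Gmax (G `|` [set (x, y)])).
  split; first exact: subsetUl.
  by move=> /(_ (x, y) (or_intror erefl)) Gxy; apply: xG; exists y.
have new p : G p -> (p.1 <> x) /\ (p.2 <> y).
  case: p => a b Gab /=; split=> e; first by apply: xG; exists b; rewrite -e.
  by apply: yG; exists a; rewrite -e.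
move=> p q [Gp|->] [Gq|->] //=; first exact: PG.
  by have [? ?] := new _ Gp; split.
by have [? ?] := new _ Gq; split=> /esym.
Qed.

Section SeqCard.
Variable X : choiceType.

Let letters (G : set (seq X * X)) : set X := [set x | exists z, G ([:: x], z)].
Let over (Y : set X) (s : seq X) := s <> [::] /\ forall x, x \in s -> Y x.

(** A coding is the graph of an injection of the nonempty sequences over some
   set Y of letters into Y. Empty sequences are left out so that the empty
   graph is a coding, and so that Y can be read off from the graph. *)
Let coding (G : set (seq X * X)) : Prop :=
  [/\ forall s x y, G (s, x) -> G (s, y) -> x = y,
      forall s t x, G (s, x) -> G (t, x) -> s = t,
      forall s, over (letters G) s <-> exists x, G (s, x)
    & forall s x, G (s, x) -> letters G x].

Let coding_bigcup (F : set (set (seq X * X))) :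
  F `<=` coding -> total_on F subset -> coding (\bigcup_(G in F) G).
Proof.
move=> FP Ftot.
have dir G H : F G -> F H -> exists2 K, F K & G `<=` K /\ H `<=` K.
  by move=> FG FH; have [GH|HG] := Ftot _ _ FG FH; [exists H|exists G]; do ?split.
split.
- move=> s x y [G FG Gx] [H FH Hy]; have [K FK [GK HK]] := dir _ _ FG FH.
  by have [f _ _ _] := FP _ FK; apply: (f s); [exact: GK|exact: HK].
- move=> s t x [G FG Gx] [H FH Hy]; have [K FK [GK HK]] := dir _ _ FG FH.
  by have [_ f _ _] := FP _ FK; apply: (f _ _ x); [exact: GK|exact: HK].
- move=> s; split; last first.
    move=> [x [G FG Gx]]; have [_ _ /(_ s)[_ /(_ (ex_intro _ x Gx))] [s0 sY] _] := FP _ FG.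
    by split=> // y /sY[z Gz]; exists z, G.
  move=> [s0 sY].
  have [G FG sG] : exists2 G, F G & forall x, x \in s -> letters G x.
    elim: s s0 sY => // x s IH _ sY.
    have [z [G FG Gz]] := sY x (mem_head _ _).
    case: s => [|y s] in IH sY *.
      by exists G => // t; rewrite inE => /eqP->; exists z.
    have [//|t ts|H FH sH] := IH; first by apply: sY; rewrite inE ts orbT.
    have [K FK [GK HK]] := dir _ _ FG FH.
    exists K => // t; rewrite inE => /predU1P[->|ts]; first by exists z; exact: GK.
    by have [w Hw] := sH _ ts; exists w; exact: HK.
  have [_ _ /(_ s)[/(_ (conj s0 sG))] [x Gx] _ _] := FP _ FG.
  by exists x, G.
- move=> s x [G FG Gx]; have [_ _ _ /(_ _ _ Gx)[z Gz]] := FP _ FG.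
  by exists z, G.
Qed.

(** A coding over Y extends to Y together with a disjoint set h W as soon as the
   nonempty sequences over the larger set inject into W: the sequences that
   are new are sent to h W. *)
Let coding_extend (G : set (seq X * X)) (W : Type) (h : W -> X) (k : seq X -> W) :
  coding G -> injective h -> (forall w, ~ letters G (h w)) ->
  (forall s t, over (letters G `|` range h) s -> over (letters G `|` range h) t ->
    k s = k t -> s = t) ->
  W -> exists2 H, coding H & G `<` H.
Proof.
move=> [G1 G2 G3 G4] hI hG kI w0; set Y := letters G `|` range h in kI.
pose H := G `|` [set p | [/\ over Y p.1, ~ over (letters G) p.1 & p.2 = h (k p.1)]].
have fieldH : letters H = Y.
  apply/seteqP; split=> [x [z [Gz|[[_ /(_ x (mem_head _ _))]]]]//|x].
  - by left; exists z.
  move=> Yx; have [[z Gz]|xG] := pselect (letters G x); first by exists z; left.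
  exists (h (k [:: x])); right; split=> //=.
    by split=> // y; rewrite inE => /eqP->.
  by move=> [_ /(_ x (mem_head _ _))].
have GY s : over (letters G) s -> over Y s by move=> [? sG]; split=> // x /sG; left.
exists H.
  split.
  - move=> s x y [Gx|[/= _ Gs ->]] [Gy|[/= _ Gs' ->]] //; first exact: G1 Gx Gy.
      by case: Gs'; apply/G3; exists x.
    by case: Gs; apply/G3; exists y.
  - move=> s t x [Gx|[/= Ys Gs ->]] [Gy|[/= Yt Gt]] //; first exact: G2 Gx Gy.
    + by move=> e; case: (hG (k t)); rewrite -e; exact: G4 Gx.
    + by case: (hG (k s)); exact: G4 Gy.
    + by move=> /hI/kI; apply.
  - move=> s; rewrite fieldH; split=> [Ys|[x [Gx|[]//]]]; last first.
      by apply: GY; apply/G3; exists x.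
    have [/G3[x Gx]|Gs] := pselect (over (letters G) s); first by exists x; left.
    by exists (h (k s)); right.
  - move=> s x; rewrite fieldH => -[/G4|[_ _ /= ->]]; first by left.
    by right; exists (k s).
split=> [|HG]; first exact: subsetUl.
have [z Hz] : letters H (h w0) by rewrite fieldH; right; exists w0.
by case: (hG w0); exists z; exact: HG.
Qed.

(** Let Y be the set of letters of a maximal coding. If the complement of Y
    contained a copy of Y, the sequences over the union would inject into Y
    (a letter of the copy becomes a sequence of length 2 over Y), and the coding
    could be extended. So the complement injects into Y, the whole of X is
    coded by sequences over Y, and so are the sequences over X. *)
Lemma seq_injects_choice : injects nat X -> injects (seq X) X.
Proof.
move=> [h0 h0I].
have [G [cG Gmax]] := Zorn_bigcup coding_bigcup.
have noext H : coding H -> ~ G `<` H by move=> cH GH; exact: Gmax GH cH.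
have [G1 G2 G3 G4] := cG.
have [[y0 Gy0]|] := pselect (exists y, letters G y); last first.
  (* The empty coding extends to the range of h0, by countability of seq nat. *)
  move=> Y0; exfalso.
  pose h0' x := xget 0%N [set n | h0 n = x].
  have h0K x : range h0 x -> h0 (h0' x) = x.
    by move=> [n _ nx]; rewrite /h0'; case: xgetP => // /(_ n).
  have [] := @coding_extend _ nat h0 (fun s => pickle (map h0' s)) cG h0I.
  - by move=> n Gn; apply: Y0; exists (h0 n).
  - move=> s t [_ sY] [_ tY] /(pcan_inj pickleK) e.
    have back r : (forall x, x \in r -> (letters G `|` range h0) x) ->
        map h0 (map h0' r) = r.
      move=> rY; rewrite -map_comp -[RHS]map_id; apply/eq_in_map => x /rY.
      by move=> [Gx|/h0K//]; case: Y0; exists x.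
    by rewrite -(back s sY) e back.
  - exact: 0%N.
  - by move=> H cH; exact: noext.
pose T := {x : X | letters G x}.
have /choice[g gP] : forall s : seq T, exists y : T, s <> [::] -> G (map sval s, sval y).
  case=> [|x s]; first by exists (exist _ y0 Gy0).
  have /G3[y Gy] : over (letters G) (map sval (x :: s)).
    split=> //; elim: (x :: s) => // z r IH y.
    by rewrite /= inE => /predU1P[->|/IH//]; exact: (svalP z).
  by exists (exist _ y (G4 _ _ Gy)).
have gI s t : s <> [::] -> t <> [::] -> g s = g t -> s = t.
  move=> s0 t0 e; apply: (inj_map (@sval_inj _ (letters G))).
  by apply: G2 (gP _ s0) _; rewrite e; exact: gP.
have [TD|[f fI]] := injects_total T {x : X | ~ letters G x}.
  case: TD => f fI; exfalso.
  pose h := fun t => sval (f t).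
  have hI : injective h by move=> x y /sval_inj/fI.
  have hG t : ~ letters G (h t) by exact: (svalP (f t)).
  have /choice[c cP] : forall x, exists z : T,
    [/\ forall Gx : letters G x, z = g [:: exist _ x Gx]
      & forall t, x = h t -> z = g [:: t; t]].
    move=> x; have [Gx|Gx] := pselect (letters G x).
      exists (g [:: exist _ x Gx]); split=> [Gx'|t xt]; last by case: (hG t); rewrite -xt.
      by congr (g [:: _]); exact: sval_inj.
    have [[t xt]|xh] := pselect (exists t, x = h t); last first.
      by exists (exist _ y0 Gy0); split=> // t xt; case: xh; exists t.
    by exists (g [:: t; t]); split=> // t'; rewrite xt => /hI->.
  have cI x y : (letters G `|` range h) x -> (letters G `|` range h) y -> c x = c y -> x = y.
    have [xG xh] := cP x; have [yG yh] := cP y.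
    move=> [Gx|[t _ tx]] [Gy|[u _ uy]].
    + by rewrite (xG Gx) (yG Gy) => /gI; case=> // -[].
    + by rewrite (xG Gx) (yh _ (esym uy)) => /gI; case.
    + by rewrite (yG Gy) (xh _ (esym tx)) => /gI; case.
    + by rewrite (yh _ (esym uy)) (xh _ (esym tx)) -tx -uy => /gI; case=> // -[->].
  have [] := @coding_extend _ T h (fun s => g (map c s)) cG hI hG.
  - move=> s t [s0 sY] [t0 tY] /gI e.
    have {}e : map c s = map c t by apply: e; [case: (s) s0|case: (t) t0].
    elim: s t {s0 t0} sY tY e => [|x s IH] [|y t] //= sY tY [cxy e].
    congr (_ :: _).
      by apply: cI => //; [apply: sY|apply: tY]; exact: mem_head.
    by apply: IH => // z zs; [apply: sY|apply: tY]; rewrite inE zs orbT.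
  - by exists y0.
  - by move=> H cH; exact: noext.
pose c x : T := match pselect (letters G x) with
  | left Gx => g [:: exist _ x Gx]
  | right Gx => let t := f (exist _ x Gx) in g [:: t; t] end.
have cI : injective c.
  move=> x y; rewrite /c; case: pselect => Gx; case: pselect => Gy /gI; case=> //.
    by case.
  by move=> [/fI[]].
(* The leading y0 makes the sequence nonempty, so that g is injective on it. *)
exists (fun s => sval (g (exist _ y0 Gy0 :: map c s))) => s t /sval_inj/gI.
by case=> // -[] /(inj_map cI).
Qed.

End SeqCard.

Lemma seq_injects (X : Type) : injects nat X -> injects (seq X) X.
Proof. exact: (@seq_injects_choice {classic X}). Qed.

Lemma injects_of_seq (X Y : Type) :
  injects nat Y -> injects X (seq Y) -> injects X Y.
Proof. by move=> /seq_injects sY XY; exact: injects_trans sY. Qed.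

Lemma sum_injects (X Y Z : Type) :
  injects nat Z -> injects X Z -> injects Y Z -> injects (X + Y) Z.
Proof.
move=> Zinf [f fI] [g gI]; apply: injects_of_seq => //.
exists (fun z => match z with inl x => [:: f x] | inr y => [:: g y; g y] end).
by case=> [x|x] [y|y] // -[] => [/fI|/gI] ->.
Qed.

Lemma prod_injects (X Y Z : Type) :
  injects nat Z -> injects X Z -> injects Y Z -> injects (X * Y) Z.
Proof.
move=> Zinf [f fI] [g gI]; apply: injects_of_seq => //.
exists (fun z => [:: f z.1; g z.2]).
by move=> [x x'] [y y'] /= [/fI-> /gI->].
Qed.

(** * Closing off under Skolem conditions *)

Definition within (X : Type) (C : set X) (s : seq X) : bool := all (mem C) s.

Definition reflects (X I : Type) (rho : I -> seq X -> seq X -> Prop) (C : set X) :=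
  forall i s, within C s -> (exists t, rho i s t) ->
    exists2 t, within C t & rho i s t.

(** The sets C below play the role of elementary substructures. A condition on C
    is a Skolem condition if it follows from the closure of C under choosing
    witnesses for at most mu relations between finite sequences. Such conditions
    are stable under conjunction, and every set is contained in a set that
    satisfies them and is not much larger. *)
Section Skolem.
Variable mu : Type.
Hypothesis mu_inf : injects nat mu.

Definition skolem (X : Type) (Phi : set X -> Prop) : Prop :=
  exists (I : Type) (rho : I -> seq X -> seq X -> Prop),
    injects I mu /\ forall C, reflects rho C -> Phi C.

(** The hull of Y is the set of values of the finite terms whose variables are
    the elements of Y and whose function symbols pick the n-th entry of a chosen
    witness. Terms are finite trees, hence coded by finite sequences. *)
Lemma skolem_hull (X : Type) (Phi : set X -> Prop) (Y : set X) :
  skolem Phi ->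
  exists2 C, Phi C & Y `<=` C /\ injects {x | C x} ({x | Y x} + mu).
Proof.
move=> [I [rho [Imu rhoPhi]]].
have /choice[w wP] : forall p : I * seq X, exists t,
    (exists t, rho p.1 p.2 t) -> rho p.1 p.2 t.
  move=> p; have [[t pt]|nt] := pselect (exists t, rho p.1 p.2 t).
    by exists t.
  by exists [::].
(* Node n (Leaf i :: ts) stands for entry n of the witness for i at ts. *)
pose T := GenTree.tree ({x | Y x} + I).
pose eval := fix eval (t : T) : option X := match t with
  | GenTree.Leaf (inl y) => Some (sval y)
  | GenTree.Node n (GenTree.Leaf (inr i) :: ts) => onth (w (i, pmap eval ts)) n
  | _ => None end.
pose C := [set x | exists t, eval t = Some x].
have evals s : within C s -> exists ts, pmap eval ts = s.
  elim: s => [|x s IH] /=; first by exists [::].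
  move=> /andP[/set_mem[t tx] /IH[ts tss]]; exists (t :: ts) => /=.
  by rewrite tx tss.
exists C.
  apply: rhoPhi => i s /evals[ts <-] /(wP (i, _)) wt.
  exists (w (i, pmap eval ts)) => //=.
  have : forall n x, onth (w (i, pmap eval ts)) n = Some x -> C x.
    by move=> n x wx; exists (GenTree.Node n (GenTree.Leaf (inr i) :: ts)).
  elim: (w _) => //= x u IH uC; apply/andP; split; first exact/mem_set/(uC 0%N).
  by apply: IH => n; exact: (uC n.+1).
split=> [x Yx|]; first by exists (GenTree.Leaf (inl (exist _ x Yx))).
have inf : injects nat ({x | Y x} + mu).
  by apply: injects_trans mu_inf _; exists inr => a b [].
apply: (@injects_trans _ T).
  apply: (@injects_rel _ _ (fun x t => eval t = Some (sval x))) => [[x]|] //.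
  by move=> [x ?] [y ?] t /= -> [xy]; exact: sval_inj.
apply: injects_of_seq => //.
apply: (@injects_trans _ (seq (nat + ({x | Y x} + I)))).
  by exists (@GenTree.encode _); exact: pcan_inj (GenTree.codeK _).
apply/injects_seq/sum_injects => //.
by apply: injects_sum => //; exists id.
Qed.

Lemma skolem_sub (X : Type) (Phi Psi : set X -> Prop) :
  (forall C, Phi C -> Psi C) -> skolem Phi -> skolem Psi.
Proof. by move=> sub [I [rho [Imu P]]]; exists I, rho; split=> // C /P/sub. Qed.

Lemma skolem_reflects (X I : Type) (rho : I -> seq X -> seq X -> Prop) :
  injects I mu -> skolem (reflects rho).
Proof. by move=> Imu; exists I, rho. Qed.

Lemma skolem_and (X : Type) (Phi Psi : set X -> Prop) :
  skolem Phi -> skolem Psi -> skolem (fun C => Phi C /\ Psi C).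
Proof.
move=> [I [rho [Imu P]]] [J [sig [Jmu Q]]].
exists (I + J)%type, (fun k => match k with inl i => rho i | inr j => sig j end).
split=> [|C refl]; first exact: sum_injects.
by split; [apply: P => i|apply: Q => j]; [exact: (refl (inl i))|exact: (refl (inr j))].
Qed.

Lemma skolem_preimage (X X' : Type) (h : X' -> X) (Phi : set X' -> Prop) :
  injective h -> skolem Phi -> skolem (fun C => Phi (h @^-1` C)).
Proof.
move=> hI [I [rho [Imu P]]].
exists I, (fun i s t => exists s' t', [/\ s = map h s', t = map h t' & rho i s' t']).
split=> // C refl; apply: P => i s sC [t st].
have [||u tC [s' [t' [/(inj_map hI) <- tt' st']]]] := refl i (map h s).
- by rewrite /within all_map.
- by exists (map h t), s, t.
by exists t' => //; move: tC; rewrite tt' /within all_map.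
Qed.

Lemma skolem_closed (X I : Type) (f : I -> seq X -> seq X) :
  injects I mu ->
  skolem (fun C => forall i s, within C s -> within C (f i s)).
Proof.
move=> Imu; apply: skolem_sub (@skolem_reflects X I (fun i s t => t = f i s) Imu).
by move=> C refl i s sC; have [|u tC <-] := refl i s sC; first by exists (f i s).
Qed.

Lemma skolem_closed1 (X : Type) (f : X -> seq X) :
  skolem (fun C => forall x, C x -> within C (f x)).
Proof.
have [] := @skolem_closed X unit (fun _ s => flatten (map f s)).
  by have [g _] := mu_inf; exists (fun _ => g 0%N) => -[] [].
move=> I [rho [Imu P]]; exists I, rho; split=> // C /P cl x Cx.
by move: (cl tt [:: x]); rewrite /= cats0; apply; rewrite /within /= mem_set.
Qed.

Lemma skolem_witness (X : Type) (r : X -> X -> Prop) :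
  skolem (fun C => forall x y, C x -> r x y -> exists2 z, C z & r x z).
Proof.
have [] := @skolem_reflects X unit
    (fun _ s t => exists x y, [/\ s = [:: x], t = [:: y] & r x y]).
  by have [g _] := mu_inf; exists (fun _ => g 0%N) => -[] [].
move=> I [rho [Imu P]]; exists I, rho; split=> // C /P refl x y Cx xy.
have [||t tC [_ [z [[<-] zt xz]]]] := refl tt [:: x].
- by rewrite /within /= mem_set.
- by exists [:: y], x, y.
by exists z => //; move: tC; rewrite zt /within /= andbT => /set_mem.
Qed.

End Skolem.

(** * Submodules, quotients and linear maps *)

Section Modules.
Variable R : pzRingType.
Implicit Types A B M N : rmod R.

Definition submodule M (S : set M) : Prop :=
  S 0 /\ forall (r : R^c) x y, S x -> S y -> S (r *: x + y).

Section SubmoduleTheory.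
Variables (M : rmod R) (S : set M).
Hypothesis subS : submodule S.

Lemma submoduleD x y : S x -> S y -> S (x + y).
Proof. by move=> Sx Sy; rewrite -[x]scale1r; exact: subS.2. Qed.

Lemma submoduleZ (r : R^c) x : S x -> S (r *: x).
Proof. by move=> Sx; rewrite -[_ *: _]addr0; apply: subS.2 => //; exact: subS.1. Qed.

Lemma submoduleN x : S x -> S (- x).
Proof. by move=> Sx; rewrite -scaleN1r; exact: submoduleZ. Qed.

Lemma submoduleB x y : S x -> S y -> S (x - y).
Proof. by move=> Sx Sy; apply: submoduleD => //; exact: submoduleN. Qed.

Lemma submodule_sum (I : Type) (s : seq I) (P : pred I) (F : I -> M) :
  (forall i, P i -> S (F i)) -> S (\sum_(i <- s | P i) F i).
Proof. by move=> SF; elim/big_ind: _ => //; [exact: subS.1|exact: submoduleD]. Qed.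

End SubmoduleTheory.

(** Linear maps between modules that are only known up to isomorphism, such as
    submodules and quotients, are all obtained from their graphs. *)
Section LinearGraph.
Variables (A B : rmod R) (G : A -> B -> Prop).
Hypothesis Gtotal : forall x, exists y, G x y.
Hypothesis Gfun : forall x y y', G x y -> G x y' -> y = y'.
Hypothesis Glin : forall (r : R^c) x x' y y',
  G x y -> G x' y' -> G (r *: x + x') (r *: y + y').

Lemma linear_of_graph : exists h : {linear A -> B}, forall x, G x (h x).
Proof.
have [h hG] := choice Gtotal.
have lin : linear h by move=> r x y; apply: (Gfun (hG _)); exact: Glin.
pose hL : {linear A -> B} := HB.pack h (GRing.isLinear.Build _ _ _ _ h lin).
by exists hL.
Qed.

End LinearGraph.

Lemma range_submodule A B (f : {linear A -> B}) : submodule (range f).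
Proof.
split; first by exists 0; rewrite ?linear0.
by move=> r _ _ [x _ <-] [y _ <-]; exists (r *: x + y); rewrite ?linearP.
Qed.

Lemma image_submodule A B (f : {linear A -> B}) (S : set A) :
  submodule S -> submodule (f @` S).
Proof.
move=> [S0 SD]; split; first by exists 0; rewrite ?linear0.
by move=> r _ _ [x Sx <-] [y Sy <-]; exists (r *: x + y); [exact: SD|rewrite linearP].
Qed.

Lemma kernel_submodule A B (f : {linear A -> B}) : submodule (kernel f).
Proof.
split; first exact: linear0.
by move=> r x y; rewrite /kernel /= linearP => -> ->; rewrite scaler0 addr0.
Qed.

(** The proof subS is an argument because the instances of closed predicates
    are found from the head constant. *)
Definition sub_pred M (S : set M) (subS : submodule S) : {pred M} := mem S.

Lemma sub_pred_closed M (S : set M) (subS : submodule S) :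
  GRing.submod_closed (sub_pred subS).
Proof.
split; first exact/mem_set/subS.1.
by move=> r x y /set_mem Sx /set_mem Sy; apply/mem_set/subS.2.
Qed.

HB.instance Definition _ M (S : set M) (subS : submodule S) :=
  GRing.isSubmodClosed.Build R^c M (sub_pred subS) (sub_pred_closed subS).

Definition sub_type M (S : set M) (subS : submodule S) := {x : M | x \in sub_pred subS}.
HB.instance Definition _ M (S : set M) (subS : submodule S) :=
  SubChoice.copy (sub_type subS) {x : M | x \in sub_pred subS}.
HB.instance Definition _ M (S : set M) (subS : submodule S) :=
  [SubChoice_isSubLmodule of sub_type subS by <:].

Lemma submodule_incl M (S : set M) : submodule S ->
  exists (A : rmod R) (j : {linear A -> M}), injective j /\ range j = S.
Proof.
move=> subS; exists (sub_type subS : rmod R), (\val : {linear _ -> _}).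
split; first exact: val_inj.
apply/seteqP; split=> [_ [x _ <-]|x Sx]; first exact/set_mem/(valP x).
by exists (Sub x (mem_set Sx)).
Qed.

Section Quotient.
Variables (M : rmod R) (S : set M) (subS : submodule S).
Local Open Scope quotient_scope.
Local Notation Q := {ideal_quot (sub_pred subS)}.

Lemma quot_eqP (x y : M) : \pi_Q x = \pi_Q y <-> S (x - y).
Proof.
split; first by move=> /eqP; rewrite piE Quotient.equivE => /set_mem.
move=> Sxy; apply/eqP; rewrite piE Quotient.equivE; exact: mem_set.
Qed.

Lemma quot_surj (x : Q) : exists y : M, x = \pi_Q y.
Proof. by exists (repr x); rewrite reprK. Qed.

Lemma quot_piD (x y : M) : \pi_Q x + \pi_Q y = \pi_Q (x + y).
Proof. by rewrite !piE. Qed.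

Definition quot_scale (r : R^c) (x : Q) : Q := \pi_Q (r *: repr x).

Lemma quot_scaleE (r : R^c) (x : M) : quot_scale r (\pi_Q x) = \pi_Q (r *: x).
Proof.
apply/quot_eqP; rewrite -scalerBr; apply: submoduleZ => //.
by apply/quot_eqP; rewrite reprK.
Qed.

Lemma quot_scaleA (a b : R^c) (x : Q) :
  quot_scale a (quot_scale b x) = quot_scale (a * b) x.
Proof. by have [y ->] := quot_surj x; rewrite !quot_scaleE scalerA. Qed.

Lemma quot_scale1 : left_id 1 quot_scale.
Proof. by move=> x; have [y ->] := quot_surj x; rewrite !quot_scaleE scale1r. Qed.

Lemma quot_scaleDr : right_distributive quot_scale +%R.
Proof.
move=> a x' y'; have [x ->] := quot_surj x'; have [y ->] := quot_surj y'.
by rewrite !quot_scaleE !quot_piD quot_scaleE scalerDr.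
Qed.

Lemma quot_scaleDl (x : Q) : {morph quot_scale^~ x : a b / a + b}.
Proof.
by have [y ->] := quot_surj x => a b /=; rewrite !quot_scaleE quot_piD scalerDl.
Qed.

HB.instance Definition _ := GRing.Zmodule_isLmodule.Build R^c Q
  quot_scaleA quot_scale1 quot_scaleDr quot_scaleDl.

Lemma quot_pi0 : \pi_Q 0 = 0.
Proof. by rewrite piE. Qed.

Lemma quotient_proj :
  exists (N : rmod R) (q : {linear M -> N}), range q = setT /\ kernel q = S.
Proof.
have lin : linear (\pi_Q : M -> Q).
  by move=> r x y; rewrite -quot_piD -quot_scaleE.
pose q : {linear M -> Q} :=
  HB.pack (\pi_Q : M -> Q) (GRing.isLinear.Build _ _ _ _ (\pi_Q : M -> Q) lin).
exists (Q : rmod R), q; split; apply/seteqP; split=> // x.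
- by move=> _; exists (repr x) => //=; exact: reprK.
- by rewrite /kernel /= -quot_pi0 => /quot_eqP; rewrite subr0.
- by move=> Sx; rewrite /kernel /= -quot_pi0; apply/quot_eqP; rewrite subr0.
Qed.

End Quotient.

End Modules.

Section Factoring.
Variable R : pzRingType.

Lemma lift_linear (A B M : rmod R) (j : {linear A -> M}) (f : {linear B -> M}) :
  injective j -> (forall x, range j (f x)) ->
  exists h : {linear B -> A}, forall x, j (h x) = f x.
Proof.
move=> jI fj; apply: (@linear_of_graph _ _ _ (fun x y => j y = f x))
  => [x|x y y' e e'|r x x' y y' e e'].
- by have [y _ yx] := fj x; exists y.
- by apply: jI; rewrite e e'.
- by rewrite !linearP e e'.
Qed.

Lemma descend_linear (M N Q : rmod R) (q : {linear M -> Q}) (f : {linear M -> N}) :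
  range q = setT -> (forall x, q x = 0 -> f x = 0) ->
  exists h : {linear Q -> N}, forall x, h (q x) = f x.
Proof.
move=> qS qf.
have [|||h hP] := @linear_of_graph _ Q N (fun y z => exists2 x, q x = y & f x = z).
- move=> y; have [x _ <-] : range q y by rewrite qS.
  by exists (f x), x.
- move=> y z z' [x qx <-] [x' qx' <-]; apply/eqP; rewrite -subr_eq0 -linearB.
  by apply/eqP/qf; rewrite linearB qx qx' subrr.
- move=> r y y' z z' [x <- <-] [x' <- <-].
  by exists (r *: x + x'); rewrite linearP.
exists h => x; have [x' qx' fx'] := hP (q x).
apply/eqP; rewrite -fx' -subr_eq0 -linearB; apply/eqP/qf.
by rewrite linearB qx' subrr.
Qed.

End Factoring.

(** * Free and projective modules through dual bases *)

Section Coordinates.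
Variable R : pzRingType.

Lemma sum_support (V : nmodType) (J : eqType) (F : J -> V) (s t : seq J) :
  uniq s -> uniq t -> (forall j, F j <> 0 -> j \in s) ->
  (forall j, F j <> 0 -> j \in t) -> \sum_(j <- s) F j = \sum_(j <- t) F j.
Proof.
move=> us ut sF tF.
have sumE u : \sum_(j <- u) F j = \sum_(j <- [seq j <- u | F j != 0]) F j.
  by rewrite big_filter [RHS]big_rmcond_in// => j _; rewrite negbK => /eqP.
rewrite (sumE s) (sumE t); apply: perm_big; apply: uniq_perm; rewrite ?filter_uniq//.
move=> j; rewrite !mem_filter; have [//|/eqP Fj] := eqVneq (F j) 0.
by rewrite sF ?tF.
Qed.

(** This is a dual basis: the coordinates c j x vanish for almost all j, and x
    is the sum of the c j x *: v j. *)
Definition coordinates (P : rmod R) (J : choiceType) (v : J -> P)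
    (c : J -> {linear P -> (R^c)^o}) : Prop :=
  forall x, exists s : seq J,
    [/\ uniq s, forall j, c j x <> 0 -> j \in s & x = \sum_(j <- s) c j x *: v j].

(** The linear map x |-> sum_j c j x *: a j; this is how a dual basis maps out of
    its module. *)
Lemma finite_sum_linear (P A : rmod R) (J : choiceType) (c : J -> {linear P -> (R^c)^o})
    (a : J -> A) :
  (forall x, exists s : seq J, forall j, c j x <> 0 -> j \in s) ->
  exists h : {linear P -> A}, forall x s, uniq s ->
    (forall j, c j x <> 0 -> j \in s) -> h x = \sum_(j <- s) c j x *: a j.
Proof.
move=> csupp.
have indep x s t : uniq s -> (forall j, c j x <> 0 -> j \in s) ->
    uniq t -> (forall j, c j x <> 0 -> j \in t) ->
    \sum_(j <- s) c j x *: a j = \sum_(j <- t) c j x *: a j.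
  move=> us sc ut tc.
  by apply: sum_support => // j ca; [apply: sc|apply: tc];
    move=> c0; apply: ca; rewrite c0 scale0r.
pose G x y := exists s, [/\ uniq s, forall j, c j x <> 0 -> j \in s
  & y = \sum_(j <- s) c j x *: a j].
have [|||h hG] := @linear_of_graph _ P A G.
- move=> x; have [s sc] := csupp x.
  exists (\sum_(j <- undup s) c j x *: a j), (undup s).
  by split=> // [|j /sc]; rewrite ?undup_uniq ?mem_undup.
- by move=> x y y' [s [us sc ->]] [t [ut tc ->]]; exact: indep.
- move=> r x x' y y' [s [us sc ->]] [t [ut tc ->]].
  pose u := undup (s ++ t).
  have uu : uniq u by rewrite undup_uniq.
  have su j : c j x <> 0 -> j \in u by move=> /sc; rewrite mem_undup mem_cat => ->.
  have tu j : c j x' <> 0 -> j \in u.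
    by move=> /tc; rewrite mem_undup mem_cat orbC => ->.
  exists u; split=> // [j|].
    rewrite linearP => cj; have [/su//|/contrapT cx] := pselect (c j x <> 0).
    by apply: tu => cx'; apply: cj; rewrite cx cx' scaler0 addr0.
  rewrite (indep x s u)// (indep x' t u)// scaler_sumr -big_split /=.
  by apply: eq_bigr => j _; rewrite linearP scalerDl scalerA.
exists h => x s us sc; have [t [ut tc ->]] := hG x; exact: indep.
Qed.

(** The modules with a dual basis are the projective ones. With b = true the dual
    basis is moreover orthonormal, and the class is that of the free modules.
    Orthonormality is only required at the nonzero v j: this allows the same
    index set J to serve for submodules and quotients, where the v j that are
    lost are replaced by 0. *)
Definition coord_class (b : bool) : module_class R := fun P =>
  exists (J : choiceType) (v : J -> P) (c : J -> {linear P -> (R^c)^o}),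
    coordinates v c /\
    (b -> forall i j, v j <> 0 -> c i (v j) = (i == j)%:R).

Lemma coord_projective b (P : rmod R) : coord_class b P -> projective P.
Proof.
move=> [J [v [c [vc _]]]] A B g f gS.
have /choice[a aP] : forall j, exists y, g y = f (v j).
  move=> j; have [y _ yj] : range g (f (v j)) by rewrite gS.
  by exists y.
have [|h hP] := @finite_sum_linear _ _ _ c a.
  by move=> x; have [s [_ sc _]] := vc x; exists s.
exists h => x; have [s [us sc {2}->]] := vc x.
rewrite (hP x s us sc) !linear_sum; apply: eq_bigr => j _.
by rewrite !linearZ aP.
Qed.

End Coordinates.

Section CoordClass.
Variable R : pzRingType.
Local Notation reg := ((R^c)^o : rmod R).

(** A projective P is a retract of the free module on its elements, and inherits
    the evaluations of that free module as coordinates. *)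
Lemma projective_coord (P : rmod R) : projective P -> coord_class false P.
Proof.
move=> projP.
pose S : set (function_module R P) :=
  [set f | exists s : seq P, forall x, f x <> 0 -> x \in s].
have subS : submodule S.
  split; first by exists [::].
  move=> r f g [s sf] [t tg]; exists (s ++ t) => x fgx; rewrite mem_cat.
  have [/sf->//|/contrapT fx] := pselect (f x <> 0).
  have [/tg->//|/contrapT gx] := pselect (g x <> 0); first by rewrite orbT.
  by case: fgx; rewrite -[LHS]/(r *: f x + g x) fx gx scaler0 addr0.
(* F is the free module on P: the functions from P to R of finite support. *)
have [F [i [iI iS]]] := submodule_incl subS.
have lin x : linear (fun f : F => (i f x : reg)).
  by move=> r f g; rewrite linearP.
pose c x : {linear F -> reg} :=
  HB.pack (fun f : F => (i f x : reg)) (GRing.isLinear.Build _ _ _ _ _ (lin x)).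
have csupp f : exists s : seq P, forall x, c x f <> 0 -> x \in s.
  by have : S (i f) by rewrite -iS; exists f.
have [p pP] := finite_sum_linear id csupp.
have pS : range p = setT.
  apply/seteqP; split=> // x _.
  pose d : function_module R P := fun y => (y == x)%:R.
  have Sd : S d.
    by exists [:: x] => y; rewrite /d inE; case: eqP.
  have [f _ fd] : range i d by rewrite iS.
  exists f => //; rewrite (pP f [:: x])//.
    by rewrite big_seq1 -[c x f]/(i f x) fd /d eqxx scale1r.
  by move=> y; rewrite -[c y f]/(i f y) fd /d inE; case: eqP.
have [h hP] := projP F P p idfun pS.
exists P, id, (fun x => c x \o h); split=> // x.
have [s sc] := csupp (h x); exists (undup s); split; rewrite ?undup_uniq//.
  by move=> j /sc; rewrite mem_undup.
rewrite -{1}(hP x : _ = x) (pP _ (undup s)) ?undup_uniq//.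
by move=> j /sc; rewrite mem_undup.
Qed.

Lemma coord_free (P : rmod R) : coord_class true P -> free_class P.
Proof.
move=> [J [v [c [vc orth]]]]; exists [set x | x <> 0 /\ range v x]; split.
  move=> s a us sB sa0 x xs.
  have [x0 [i _ ix]] := sB x xs.
  have := congr1 (c i) sa0; rewrite linear0 linear_sum (bigD1_seq x)//= big_seq_cond.
  rewrite big1 => [|y /andP[/sB[y0 [j _ jy]] yx]].
    rewrite addr0 linearZ -ix orth ?ix// eqxx => e.
    by rewrite -[a x]mulr1; exact: e.
  rewrite linearZ -jy orth ?jy//; case: eqP => [ij|_]; last exact: scaler0.
  by move: yx; rewrite -jy -ix ij eqxx.
move=> y; have [s [us sc ys]] := vc y.
(* Terms with the same v j are grouped: coefficients are indexed by vectors. *)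
pose t := undup [seq x <- map v s | x != 0].
exists t, (fun x => \sum_(j <- s | v j == x) c j y); split.
  move=> x; rewrite mem_undup mem_filter => /andP[/eqP x0 /mapP[j _ xj]].
  by split=> //; exists j.
transitivity (\sum_(x <- t) \sum_(j <- s | v j == x) c j y *: v j).
  rewrite {1}ys.
  rewrite (exchange_big_dep xpredT)//= big_seq [RHS]big_seq.
  apply: eq_bigr => j js.
  have [vj|vj] := eqVneq (v j) 0.
    by rewrite vj scaler0 big1.
  rewrite (eq_bigl (pred1 (v j))) => [|x]; last by rewrite eq_sym.
  rewrite -big_filter filter_pred1_uniq ?undup_uniq ?big_seq1//.
  by rewrite mem_undup mem_filter vj map_f.
apply: eq_bigr => x _; rewrite scaler_suml; apply: eq_bigr => j /eqP->.
by [].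
Qed.

(** The coordinates of y are its coefficients on the basis. They are handled
    through the relation rep y a, that y is the combination of the basis with
    finitely supported coefficients a, because rep is linear and a = 0 when
    y = 0. *)
Lemma free_coord (P : rmod R) : free_class P -> coord_class true P.
Proof.
move=> [B [Bfree Bspan]].
pose rep (y : P) (a : P -> R^c) := exists s : seq P, [/\ uniq s,
  forall x, x \in s -> B x, forall x, a x <> 0 -> x \in s & y = \sum_(x <- s) a x *: x].
have rep_lin (r : R^c) y y' a a' : rep y a -> rep y' a' ->
    rep (r *: y + y') (fun x => r * a x + a' x).
  move=> [s [us sB sa ->]] [t [ut tB ta ->]].
  pose u := undup (s ++ t).
  have ext (w : seq P) (b : P -> R^c) : uniq w -> (forall x, b x <> 0 -> x \in w) ->
      {subset w <= u} -> \sum_(x <- w) b x *: x = \sum_(x <- u) b x *: x.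
    move=> uw wb wu.
    by apply: sum_support => // [|x bx|x bx]; rewrite ?undup_uniq//; [|apply: wu];
      apply: wb => b0; apply: bx; rewrite b0 scale0r.
  have su : {subset s <= u} by move=> x xs; rewrite mem_undup mem_cat xs.
  have tu : {subset t <= u} by move=> x xt; rewrite mem_undup mem_cat xt orbT.
  exists u; split.
  - exact: undup_uniq.
  - by move=> x; rewrite mem_undup mem_cat => /orP[/sB|/tB].
  - move=> x ax; have [/sa/su//|/contrapT a0] := pselect (a x <> 0).
    by apply/tu/ta => a'0; apply: ax; rewrite a0 a'0 mulr0 addr0.
  - rewrite (ext s a)// (ext t a')// scaler_sumr -big_split /=.
    by apply: eq_bigr => x _; rewrite scalerDl scalerA.
have rep0 a : rep 0 a -> forall x, a x = 0.
  move=> [s [us sB sa e]] x; apply/eqP; apply: contraT => /eqP ax.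
  by have := Bfree s a us sB (esym e) x (sa x ax).
have rep_fun y a a' : rep y a -> rep y a' -> forall x, a x = a' x.
  move=> ya ya' x; have := rep_lin (-1) y y a' a ya' ya.
  rewrite scaleN1r addNr => /rep0/(_ x); rewrite mulN1r addrC => /eqP.
  by rewrite subr_eq0 => /eqP.
have rep_basis x : B x -> rep x (fun y => (y == x)%:R).
  move=> Bx; exists [:: x]; split=> // [y|y|]; rewrite ?inE ?big_seq1 ?eqxx ?scale1r//.
  - by move=> /eqP->.
  - by case: eqP.
have rep_zero : rep 0 (fun _ => 0) by exists [::]; rewrite big_nil.
have /choice[a aP] y : exists a, rep y a.
  have [s [c [sB ->]]] := Bspan y.
  elim: s sB => [|x s IH] sB; first by exists (fun=> 0); rewrite big_nil.
  have [|b sb] := IH; first by move=> z zs; apply: sB; rewrite inE zs orbT.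
  have Bx := sB x (mem_head _ _).
  by rewrite big_cons; eexists; apply: rep_lin (rep_basis _ Bx) sb.
have lin x : linear (fun y => (a y x : reg)).
  by move=> r y y'; exact: (rep_fun _ _ _ (aP _) (rep_lin r _ _ _ _ (aP y) (aP y')) x).
pose c x : {linear P -> reg} :=
  HB.pack (fun y => (a y x : reg)) (GRing.isLinear.Build _ _ _ _ _ (lin x)).
exists P, (fun x => if pselect (B x) then x else 0), c; split.
  move=> y; have [s [us sB sa ys]] := aP y; exists s; split=> //.
  rewrite {1}ys big_seq [RHS]big_seq; apply: eq_bigr => x /sB Bx.
  by case: pselect.
move=> _ i j; case: pselect => // Bj _.
exact: (rep_fun _ _ _ (aP _) (rep_basis _ Bj)).
Qed.

End CoordClass.

(** * Clean submodules of free and projective modules *)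

Definition short_exact (R : pzRingType) (A B C : rmod R)
    (f : {linear A -> B}) (g : {linear B -> C}) : Prop :=
  [/\ injective f, range g = setT & range f = kernel g].

Section ShortExact.
Variables (R : pzRingType) (A B C : rmod R).
Variables (f : {linear A -> B}) (g : {linear B -> C}).
Hypothesis fg : short_exact f g.

Lemma short_exact0 x : g (f x) = 0.
Proof. by have [_ _ fgE] := fg; have : kernel g (f x) by rewrite -fgE; exists x. Qed.

Lemma short_exact_ker y : g y = 0 -> exists x, f x = y.
Proof.
by have [_ _ fgE] := fg => gy; have [x _ <-] : range f y by [rewrite fgE]; exists x.
Qed.

Lemma short_exact_surj z : exists y, g y = z.
Proof. by have [_ gS _] := fg; have [y _ <-] : range g z by [rewrite gS]; exists y. Qed.

End ShortExact.

(** S and M / S belong to K, each standing for all its isomorphic copies. *)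
Definition clean_submodule (R : pzRingType) (K : module_class R) (M : rmod R)
    (S : set M) : Prop :=
  [/\ submodule S,
      forall (A : rmod R) (j : {linear A -> M}), injective j -> range j = S -> K A
    & forall (Q : rmod R) (q : {linear M -> Q}), range q = setT -> kernel q = S -> K Q].

Section CoordHull.
Variable R : pzRingType.
Local Notation reg := ((R^c)^o : rmod R).

(** If S contains v j whenever some element of S has a nonzero j-th coordinate,
    the dual basis splits: the v j in S, with the restrictions of the c j, form a
    dual basis of S, and the images of the other v j form one of the quotient,
    because c j vanishes on S when v j is not in S. *)
Section Support.
Variables (b : bool) (P : rmod R) (J : choiceType) (v : J -> P) (c : J -> {linear P -> reg}).
Hypotheses (vc : coordinates v c)
  (orth : b -> forall i j, v j <> 0 -> c i (v j) = (i == j)%:R).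
Variable S : set P.
Hypothesis Ssupp : forall x j, S x -> c j x <> 0 -> S (v j).

Lemma coord_submodule (A : rmod R) (i : {linear A -> P}) :
  injective i -> range i = S -> coord_class b A.
Proof.
move=> iI iS.
have /choice[w wP] j : exists y : A, (S (v j) -> i y = v j) /\ (~ S (v j) -> y = 0).
  have [Sj|Sj] := pselect (S (v j)); last by exists 0.
  by have [y _ yj] : range i (v j) by [rewrite iS]; exists y.
exists J, w, (fun j => c j \o i); split=> [x|bT j k wk].
  have [s [us sc xs]] := vc (i x); exists s; split=> //.
  apply: iI; rewrite {1}xs linear_sum; apply: eq_bigr => j _ /=.
  rewrite linearZ; have [Sj|Sj] := pselect (S (v j)); first by rewrite (wP j).1.
  have cj0 : c j (i x) = 0.
    by apply: contrapT => /(Ssupp _) cj; apply/Sj/cj; rewrite -iS; exists x.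
  by rewrite /= cj0 !scale0r.
have [Sk|Sk] := pselect (S (v k)); last by case: wk; exact: (wP k).2.
have [/(_ Sk) wkE _] := wP k.
rewrite /= wkE orth// => vk; apply: wk; apply: iI.
by rewrite wkE vk linear0.
Qed.

Lemma coord_quotient (Q : rmod R) (q : {linear P -> Q}) :
  range q = setT -> kernel q = S -> coord_class b Q.
Proof.
move=> qS qK.
have q0 x : S x -> q x = 0 by rewrite -qK.
have /choice[d dP] j : exists d : {linear Q -> reg},
    (S (v j) -> forall y, d y = 0) /\ (~ S (v j) -> forall x, d (q x) = c j x).
  have [Sj|Sj] := pselect (S (v j)); first by exists \0.
  have [|d dP] := descend_linear (f := c j) qS; last by exists d.
  move=> x qx; apply: contrapT => cx; apply: Sj.
  by apply: Ssupp cx; rewrite -qK.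
exists J, (q \o v), d; split=> [y|bT i j /= qj].
  have [x _ <-] : range q y by rewrite qS.
  have [s [us sc xs]] := vc x; exists s; split=> //.
    move=> j dj; apply: sc => cj; apply: dj.
    have [Sj|Sj] := pselect (S (v j)); first by rewrite (dP j).1.
    by rewrite (dP j).2.
  rewrite {1}xs linear_sum; apply: eq_bigr => j _; rewrite linearZ /=.
  have [Sj|Sj] := pselect (S (v j)); first by rewrite (q0 _ Sj) !scaler0.
  by rewrite (dP j).2.
have Sj : ~ S (v j) by move=> /q0.
have [Si|Si] := pselect (S (v i)).
  by rewrite (dP i).1//; case: eqP => // ij; case: Sj; rewrite -ij.
by rewrite (dP i).2// orth// => vj; apply: qj; rewrite vj linear0.
Qed.

End Support.

Section Hull.
Variable mu : Type.
Hypotheses (mu_inf : injects nat mu) (R_mu : injects R mu).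

Lemma skolem_submodule (M : rmod R) : skolem mu (@submodule R M).
Proof.
have := @skolem_closed mu M R (fun r s => match s with
  | [::] => [:: 0] | [:: x; y] => [:: (r : R^c) *: x + y] | _ => [::] end) R_mu.
apply: skolem_sub => C cl; split.
  by have := cl 0 [::] isT; rewrite /within /= andbT => /set_mem.
move=> r x y Cx Cy; have := cl r [:: x; y].
by rewrite /within /= (mem_set Cx) (mem_set Cy) !andbT => /(_ isT)/set_mem.
Qed.

Lemma coord_hull b (P : rmod R) :
  coord_class b P -> skolem mu (@clean_submodule R (coord_class b) P).
Proof.
move=> [J [v [c [vc orth]]]].
have /choice[s sP] := vc.
have := @skolem_closed1 mu mu_inf P (fun x => [seq v j | j <- s x & c j x != 0]).
move=> /(skolem_and mu_inf (skolem_submodule P)); apply: skolem_sub => C [subC cl].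
have Csupp x j : C x -> c j x <> 0 -> C (v j).
  move=> Cx cj; have [_ /(_ j cj) js _] := sP x.
  apply/set_mem/(allP (cl x Cx))/map_f.
  by rewrite mem_filter js andbT; exact/eqP.
split=> //.
- by move=> A i iI iC; exact: (coord_submodule vc orth Csupp iI iC).
- by move=> Q q qS qC; exact: (coord_quotient vc orth Csupp qS qC).
Qed.

End Hull.

(** The sequence splits, and the dual bases of A and C are put together. *)
Lemma coord_extension b (A B C : rmod R) (f : {linear A -> B}) (g : {linear B -> C}) :
  short_exact f g -> coord_class b A -> coord_class b C -> coord_class b B.
Proof.
move=> fg cA cC; have [fI gS _] := fg.
have [s sP] := coord_projective cC idfun gS.
have [r rP] : exists r : {linear B -> A}, forall x, f (r x) = x - s (g x).
  have lin : linear (fun x => x - s (g x)).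
    by move=> a x y; rewrite (linearP g) (linearP s) scalerBr opprD addrACA.
  pose t : {linear B -> B} :=
    HB.pack (fun x => x - s (g x)) (GRing.isLinear.Build _ _ _ _ _ lin).
  have [|r rP] := @lift_linear _ A B B f t fI.
    move=> x; have [|y yx] := short_exact_ker fg (y := t x); last by exists y.
    by rewrite [t x]/(x - s (g x)) linearB sP subrr.
  by exists r.
have rs z : r (s z) = 0 by apply: fI; rewrite rP sP subrr linear0.
have rf x : r (f x) = x.
  by apply: fI; rewrite rP (short_exact0 fg) linear0 subr0.
case: cA cC => J [v [c [vc orth]]] [I [w [d [wd orth']]]].
exists (J + I)%type.
exists (fun k => match k with inl j => f (v j) | inr i => s (w i) end).
exists (fun k => match k return {linear B -> reg} with
  | inl j => c j \o r | inr i => d i \o g end).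
split=> [x|bT].
  have [s1 [us1 sc1 x1]] := vc (r x); have [s2 [us2 sc2 x2]] := wd (g x).
  exists (map inl s1 ++ map inr s2); split.
  - rewrite cat_uniq !map_inj_uniq ?us1 ?us2 ?andbT//=; do ?by move=> ? ? [].
    by apply/hasPn => _ /mapP[i _ ->]; apply/mapP => -[].
  - move=> [j|i] /= cx; rewrite mem_cat; apply/orP.
      by left; apply: map_f; exact: sc1.
    by right; apply: map_f; exact: sc2.
  - rewrite big_cat !big_map /=.
    have {1}-> : x = f (r x) + s (g x) by rewrite rP subrK.
    rewrite {1}x1 {1}x2 !linear_sum.
    by congr (_ + _); apply: eq_bigr => k _; rewrite linearZ.
move=> [j|i] [j'|i'] /= k0.
- by rewrite rf orth// => v0; apply: k0; rewrite v0 linear0.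
- by rewrite rs linear0.
- by rewrite (short_exact0 fg) linear0.
- by rewrite sP orth'// => w0; apply: k0; rewrite w0 linear0.
Qed.

End CoordHull.

(** * Modules of bounded projective dimension *)

Section ProjDim.
Variable R : pzRingType.

(** For b = false this is projective dimension at most n, with the resolution
    replaced by one syzygy at a time so that arguments go by induction on n. The
    free modules are the case b = true, n = 0. *)
Fixpoint pd_class (b : bool) (n : nat) : module_class R :=
  if n is n'.+1 then fun M =>
    exists (P L : rmod R) (f : {linear L -> P}) (e : {linear P -> M}),
      [/\ coord_class false P, pd_class b n' L & short_exact f e]
  else coord_class b.

(** A short exact sequence restricts to an exact sequence of submodules f^-1 T,
    T and S = e T, and therefore induces one of the quotients by them. *)
Section Submodules.
Variables (L P M : rmod R) (f : {linear L -> P}) (e : {linear P -> M}).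
Hypothesis fe : short_exact f e.
Variables (T : set P) (S : set M).
Hypothesis eT : e @` T = S.

Lemma exact_submodule (L' P' M' : rmod R) (i : {linear L' -> L})
    (j : {linear P' -> P}) (k : {linear M' -> M}) :
  injective i -> range i = f @^-1` T -> injective j -> range j = T ->
  injective k -> range k = S ->
  exists (f' : {linear L' -> P'}) (e' : {linear P' -> M'}), short_exact f' e'.
Proof.
move=> iI iE jI jE kI kE; have [fI _ _] := fe.
have [|f' f'P] := @lift_linear _ P' L' P j (f \o i) jI.
  by move=> x; rewrite jE -[T _]/((f @^-1` T) (i x)) -iE; exists x.
have [|e' e'P] := @lift_linear _ M' P' M k (e \o j) kI.
  by move=> x; rewrite kE -eT; exists (j x) => //; rewrite -jE; exists x.
exists f', e'; split.
- by move=> x y /(congr1 j); rewrite !f'P => /fI/iI.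
- apply/seteqP; split=> // z _; have : S (k z) by rewrite -kE; exists z.
  rewrite -eT => -[p]; rewrite -jE => -[p' _ <-] ez.
  by exists p' => //; apply: kI; rewrite e'P.
- apply/seteqP; split=> [_ [x _ <-]|p].
    by apply: kI; rewrite e'P /= f'P /= (short_exact0 fe) linear0.
  rewrite /kernel /= => /(congr1 k); rewrite e'P linear0 /=.
  move=> /(short_exact_ker fe)[l fl].
  have [l' _ il] : range i l by rewrite iE /preimage /= fl -jE; exists p.
  by exists l' => //; apply: jI; rewrite f'P /= il.
Qed.

Lemma exact_quotient (L' P' M' : rmod R) (i : {linear L -> L'})
    (j : {linear P -> P'}) (k : {linear M -> M'}) :
  range i = setT -> kernel i = f @^-1` T -> range j = setT -> kernel j = T ->
  range k = setT -> kernel k = S ->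
  exists (f' : {linear L' -> P'}) (e' : {linear P' -> M'}), short_exact f' e'.
Proof.
move=> iS iE jS jE kS kE; have [fI _ _] := fe.
have [|f' f'P] := @descend_linear _ L P' L' i (j \o f) iS.
  move=> x ix /=; have : kernel i x by [].
  by rewrite iE /preimage /= -jE.
have [|e' e'P] := @descend_linear _ P M' P' j (k \o e) jS.
  move=> x jx /=; have : T x by rewrite -jE.
  by move=> Tx; have : S (e x) by [rewrite -eT; exists x]; rewrite -kE.
exists f', e'; split.
- apply: raddf_inj => y; have [x _ <-] : range i y by rewrite iS.
  rewrite /= f'P /= => jfx; have : kernel j (f x) by [].
  by rewrite jE -[T _]/((f @^-1` T) x) -iE.
- apply/seteqP; split=> // z _; have [m _ <-] : range k z by rewrite kS.
  by have [p <-] := short_exact_surj fe m; exists (j p); rewrite ?e'P.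
- apply/seteqP; split=> [_ [y _ <-]|y].
    have [x _ <-] : range i y by rewrite iS.
    by rewrite /kernel /= f'P /= e'P /= (short_exact0 fe) linear0.
  have [p _ <-] : range j y by rewrite jS.
  rewrite /kernel /= e'P /= => kep; have : S (e p) by rewrite -kE.
  rewrite -eT => -[t Tt et].
  have [|l fl] := short_exact_ker fe (y := p - t); first by rewrite linearB et subrr.
  exists (i l) => //; rewrite f'P /= fl linearB.
  by have -> : j t = 0 by [move: Tt; rewrite -jE]; rewrite subr0.
Qed.

End Submodules.

(** The extra elements Z are those of the projective modules of a resolution.
    Given a syzygy L of M in P, a closed set meets P in a submodule compatible
    with its dual basis, meets L in a clean submodule, and its trace on M is the
    image of its trace on P; then the submodules of L, P and M form an exact
    sequence, and so do the quotients. Since L is contained in P, its elements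
    are not added a second time: L is closed when its image is. *)
Lemma pd_hull (mu : Type) (b : bool) (n : nat) (M : rmod R) :
  injects nat mu -> injects R mu -> pd_class b n M ->
  exists Z : Type, skolem mu (fun C : set (M + Z) =>
    clean_submodule (pd_class b n) (inl @^-1` C)).
Proof.
move=> mu_inf R_mu; elim: n M => [|n IH] M /=.
  move=> cM; exists void; have := coord_hull mu_inf R_mu cM.
  by apply: skolem_preimage; move=> x y [].
move=> [P [L [f [e [cP pL fe]]]]]; have [fI _ _] := fe.
have [Z hL] := IH L pL; exists (P + Z)%type.
pose X := (M + (P + Z))%type.
pose inP (p : P) : X := inr (inl p).
pose h (x : L + Z) : X := match x with inl l => inP (f l) | inr z => inr (inr z) end.
have hI : injective h by case=> [x|x] [y|y] // [] => [/fI|] ->.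
have inPI : injective inP by move=> x y [].
have c1 := skolem_preimage inPI (coord_hull mu_inf R_mu cP).
have c2 := skolem_preimage hI hL.
have c3 := @skolem_closed1 mu mu_inf X (fun x => match x with
  | inr (inl p) => [:: inl (e p)] | _ => [::] end).
have c4 := @skolem_witness mu mu_inf X (fun x y => exists2 p, inl (e p) = x & y = inP p).
have := skolem_and mu_inf (skolem_and mu_inf c1 c2) (skolem_and mu_inf c3 c4).
apply: skolem_sub => C [[[subP subPA subPQ] [subL subLA subLQ]] [eC Ce]].
have eT : e @` (inP @^-1` C) = inl @^-1` C.
  apply/seteqP; split=> [_ [p Cp <-]|m Cm].
    by have := eC _ Cp; rewrite /within /= andbT => /set_mem.
  have [p ep] := short_exact_surj fe m.
  have [|z Cz [p' [ep' zp']]] := Ce (inl m) (inP p) Cm; first by exists p; rewrite ?ep.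
  by exists p'; [rewrite /preimage /= -zp'|case: ep'].
have [P' [jP [jPI jPE]]] := submodule_incl subP.
have [L' [jL [jLI jLE]]] := submodule_incl subL.
have [P'' [qP [qPS qPE]]] := quotient_proj subP.
have [L'' [qL [qLS qLE]]] := quotient_proj subL.
split=> [|A i iI iE|Q q qS qE].
- by rewrite -eT; exact: image_submodule.
- have [f' [e' fe']] := exact_submodule fe eT jLI jLE jPI jPE iI iE.
  by exists P', L', f', e'; split=> //; [exact: subPA jPE|exact: subLA jLE].
- have [f' [e' fe']] := exact_quotient fe eT qLS qLE qPS qPE qS qE.
  by exists P'', L'', f', e'; split=> //; [exact: subPQ qPE|exact: subLQ qLE].
Qed.

(** This is the horseshoe lemma: P * P' maps onto B, and the kernel is an extension
    of the syzygy of C by that of A. *)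
Lemma pd_extension (b : bool) (n : nat) (A B C : rmod R)
    (f : {linear A -> B}) (g : {linear B -> C}) :
  short_exact f g -> pd_class b n A -> pd_class b n C -> pd_class b n B.
Proof.
elim: n A B C f g => [|n IH] A B C f g fg; first exact: coord_extension fg.
move=> [P [L [k [e [cP pL ke]]]]] [P' [L' [k' [e' [cP' pL' ke']]]]].
have [fI gS _] := fg.
have [s sP] := coord_projective cP' e' gS.
have linE : linear (fun x : P * P' => f (e x.1) + s x.2).
  by move=> r x y /=; rewrite !linearP scalerDr addrACA.
have [E EE] : exists E : {linear (P * P')%type -> B},
    forall x, E x = f (e x.1) + s x.2.
  pose E : {linear (P * P')%type -> B} :=
    HB.pack (fun x : P * P' => f (e x.1) + s x.2)
      (GRing.isLinear.Build _ _ _ _ _ linE).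
  by exists E.
have [N [j [jI jE]]] := submodule_incl (kernel_submodule E).
have linl : linear (fun x : P => (x, 0) : P * P').
  by move=> r x y; congr (_, _); rewrite /= scaler0 addr0.
pose il : {linear P -> (P * P')%type} :=
  HB.pack (fun x : P => (x, 0) : P * P') (GRing.isLinear.Build _ _ _ _ _ linl).
have cPP : coord_class false (P * P')%type.
  apply: (@coord_extension _ _ P _ P' il snd) => //; split.
  - by move=> x y [].
  - by apply/seteqP; split=> // y _; exists (0, y).
  - apply/seteqP; split=> [_ [x _ <-]//|[x y]]; rewrite /kernel /= => ->.
    by exists x.
exists (P * P')%type, N, j, E; split=> //; last first.
  split=> //; apply/seteqP; split=> // y _.
  have [z ez] := short_exact_surj ke' (g y).
  have [|a fa] := short_exact_ker fg (y := y - s z).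
    by rewrite linearB sP ez subrr.
  have [x ex] := short_exact_surj ke a.
  by exists (x, z) => //; rewrite EE /= ex fa subrK.
have jK x : E (j x) = 0 by have : kernel E (j x) by [rewrite -jE; exists x].
have [|u uP] := @lift_linear _ N L (P * P')%type j (il \o k) jI.
  by move=> x; rewrite jE /kernel /= EE /= (short_exact0 ke) !linear0 addr0.
have [kI' _ kE'] := ke'; have [kI _ _] := ke.
have [|w wP] := @lift_linear _ L' N P' k' (snd \o j) kI'.
  move=> x; rewrite kE' /kernel /= -sP.
  by have := congr1 g (jK x); rewrite EE linearD (short_exact0 fg) add0r linear0.
apply: (IH L N L' u w) => //; split.
- by move=> x y /(congr1 j); rewrite !uP => -[] /kI.
- apply/seteqP; split=> // l _.
  have [|a fa] := short_exact_ker fg (y := s (k' l)).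
    by rewrite sP (short_exact0 ke').
  have [x ex] := short_exact_surj ke (- a).
  have [y _ jy] : range j (x, k' l).
    by rewrite jE /kernel /= EE /= ex linearN fa addNr.
  by exists y => //; apply: kI'; rewrite wP /= jy.
- apply/seteqP; split=> [_ [x _ <-]|y].
    by apply: kI'; rewrite wP /= uP /= linear0.
  rewrite /kernel /= => /(congr1 k'); rewrite wP linear0 /= => y0.
  have := jK y; rewrite EE y0 linear0 addr0.
  rewrite -[RHS](linear0 f) => /fI/(short_exact_ker ke)[x kx].
  exists x => //; apply: jI; rewrite uP /=.
  by rewrite kx -y0; case: (j y).
Qed.

Lemma pd_of_resolution n (M : rmod R) : proj_dim_le n M -> pd_class false n M.
Proof.
elim: n M => [|n IH] M [P [d [e [projP Pn eS d0 dE]]]].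
  have eI x : kernel e x -> x = 0.
    by rewrite -d0 => -[y _ <-]; rewrite (Pn 1%N isT y) linear0.
  have [J [v [c [vc orth]]]] := projective_coord (projP 0%N).
  apply: (coord_quotient vc orth (S := kernel e)) eS erefl.
  by move=> x j /eI-> /=; rewrite linear0.
have [L [f [fI fE]]] := submodule_incl (kernel_submodule e).
have [|e' e'P] := @lift_linear _ L (P 1%N) (P 0%N) f (d 0%N) fI.
  by move=> x; rewrite fE -d0; exists x.
exists (P 0%N), L, f, e; split=> //; first exact: projective_coord.
apply: IH; exists (fun i => P i.+1), (fun i => d i.+1), e'; split=> //.
- by move=> i ni; exact: Pn.
- apply/seteqP; split=> // y _; have : range f (f y) by exists y.
  by rewrite fE -d0 => -[x _ dx]; exists x => //; apply: fI; rewrite e'P.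
- rewrite dE; apply/seteqP; split=> x; rewrite /kernel /= -e'P.
    by rewrite -[X in _ = X -> _](linear0 f) => /fI.
  by move=> ->; rewrite linear0.
Qed.

Lemma resolution_of_pd n (M : rmod R) : pd_class false n M -> proj_dim_le n M.
Proof.
elim: n M => [|n IH] M.
  move=> /coord_projective projM.
  have sub0 : submodule [set 0 : M].
    by split=> // r x y /= -> ->; rewrite scaler0 addr0.
  have [Z [j [jI jE]]] := submodule_incl sub0.
  have Z0 (z : Z) : z = 0.
    apply: jI; rewrite linear0.
    by have : range j (j z) by [exists z]; rewrite jE.
  exists (fun i => if i is 0%N then M else Z), (fun i => \0), idfun; split.
  - case=> // i A B g f gS; exists \0 => x; rewrite linear0 /=.
    by rewrite (Z0 x) linear0.
  - by case=> // i _ x; exact: Z0.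
  - by apply/seteqP; split=> // x _; exists x.
  - by apply/seteqP; split=> [_ [x _ <-]//|x x0]; exists 0; rewrite // -[x]x0.
  - move=> i; apply/seteqP; split=> [_ [x _ <-]//|x _ /=].
    by exists 0; rewrite // (Z0 x).
move=> [P0 [L [f [e0 [/coord_projective projP0 /IH[P [d [e [projP Pn eS d0 dE]]]] fe]]]]].
have [fI e0S fE] := fe.
pose P' i : rmod R := if i is i'.+1 then P i' else P0.
pose d' i : {linear P' i.+1 -> P' i} :=
  match i return {linear P' i.+1 -> P' i} with 0%N => f \o e | i'.+1 => d i' end.
exists P', d', e0; split=> //.
- by case=> [|i]; [exact: projP0|exact: projP].
- by case=> // i ni; exact: Pn.
- rewrite -fE; apply/seteqP; split=> [_ [x _ <-]|_ [y _ <-]]; first by exists (e x).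
  by have [x _ <-] : range e y by [rewrite eS]; exists x.
- case=> [|i] /=; last exact: dE.
  rewrite d0; apply/seteqP; split=> x; rewrite /kernel /=; first by move=> ->; rewrite linear0.
  by rewrite -[X in _ = X -> _](linear0 f) => /fI.
Qed.

End ProjDim.

(** * Purity for a class of linear systems *)

Section Purity.
Variable R : pzRingType.

Definition system_class := forall m k : nat, ('I_m -> 'I_k -> R^c) -> Prop.

Definition pure_for (T : system_class) (M : rmod R) (N : set M) : Prop :=
  forall (m k : nat) (a : 'I_m -> 'I_k -> R^c) (b : 'I_m -> M), T m k a ->
    (forall i, N (b i)) -> (exists x, system_solution a b x) ->
    exists2 x, (forall j, N (x j)) & system_solution a b x.

Lemma RD_pure_for (M : rmod R) (N : set M) : submodule N ->
  RD_subset N <-> pure_for (fun m k _ => m = 1%N /\ k = 1%N) N.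
Proof.
move=> subN; split=> [RD m k a b [m1 k1]|pureN r].
  subst m k => Nb [x ax].
  have : (N `&` [set a ord0 ord0 *: y | y in [set: M]]) (b ord0).
    by split; [exact: Nb|exists (x ord0); rewrite // -ax big_ord1].
  rewrite RD => -[y Ny yb]; exists (fun=> y) => // i.
  by rewrite big_ord1 (ord1 i).
apply/seteqP; split=> [z [Nz [x _ rx]]|_ [x Nx <-]]; last first.
  by split; [exact: submoduleZ|exists x].
have [|||y Ny ay] := pureN 1%N 1%N (fun _ _ => r) (fun=> z).
- by [].
- by [].
- by exists (fun=> x) => i; rewrite big_ord1.
by exists (y ord0) => //; rewrite -(ay ord0) big_ord1.
Qed.

(** The three kinds of embeddings differ only in the systems that they reflect:
    none, those of one equation in one unknown, and all. *)
Lemma embedding_classes (M : morphism_class R) :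
  M = @embedding R \/ M = @RD_embedding R \/ M = @pure_embedding R ->
  exists T : system_class, forall (A B : rmod R) (f : {linear A -> B}),
    M A B f <-> injective f /\ pure_for T (range f).
Proof.
case=> [->|[->|->]].
- by exists (fun _ _ _ => False) => A B f; split=> [fI|[]//]; split.
- exists (fun m k _ => m = 1%N /\ k = 1%N) => A B f.
  by split=> -[fI fP]; split=> //; move: fP; rewrite RD_pure_for//; exact: range_submodule.
- exists (fun _ _ _ => True) => A B f.
  by split=> -[fI fP]; split=> //; [move=> m k a b _|move=> m k a b]; exact: fP.
Qed.

(** When C and D are submodules, this is purity of (C + D) / D in M / D; in
    terms of elements of M it is a Skolem condition on C. *)
Definition pure_over (T : system_class) (M : rmod R) (D C : set M) : Prop :=
  forall (m k : nat) (a : 'I_m -> 'I_k -> R^c) (b : 'I_m -> M), T m k a ->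
    (forall i, C (b i)) ->
    (exists x d, (forall i, D (d i)) /\ system_solution a (fun i => b i + d i) x) ->
    exists x d, [/\ forall j, C (x j), forall i, D (d i)
                  & system_solution a (fun i => b i + d i) x].

(** Purity is transitive along D <= D + C <= M: a system over D + C is solved
    modulo D by C, and the error, a system over D, is solved in D. *)
Lemma pure_over_sum (T : system_class) (M : rmod R) (D C : set M) :
  submodule D -> pure_for T D -> pure_over T D C ->
  pure_for T [set x + y | x in D & y in C].
Proof.
move=> subD pureD CD m k a b Ta DCb [x ax].
have /choice[p pP] i : exists p : M * M, [/\ D p.1, C p.2 & b i = p.1 + p.2].
  by have [d Dd [c Cc <-]] := DCb i; exists (d, c).
have [||y [d [Cy Dd ay]]] := CD m k a (fun i => (p i).2) Ta.
- by move=> i; have [] := pP i.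
- exists x, (fun i => (p i).1); split=> i; have [// _ _ bi] := pP i.
  by rewrite ax bi addrC.
have [||z Dz az] := pureD m k a (fun i => (p i).1 - d i) Ta.
- by move=> i; apply: submoduleB => //; have [] := pP i.
- exists (fun j => x j - y j) => i.
  under eq_bigr do rewrite scalerBr.
  have [_ _ bi] := pP i.
  by rewrite sumrB ax ay bi [_.2 + _]addrC opprD addrACA subrr addr0.
exists (fun j => z j + y j) => [j|i]; first by exists (z j) => //; exists (y j).
under eq_bigr do rewrite scalerDr.
have [_ _ ->] := pP i.
by rewrite big_split /= az ay addrA addrAC subrK addrC.
Qed.

Lemma skolem_pure_over (mu : Type) (T : system_class) (M : rmod R) (D : set M) :
  injects nat mu -> injects R mu -> skolem mu (pure_over T D).
Proof.
move=> mu_inf R_mu.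
pose I := (nat * nat * seq (seq R))%type.
pose mx (i : I) : 'I_i.1.1 -> 'I_i.1.2 -> R^c :=
  fun j l => nth (0 : R^c) (nth [::] i.2 j) l.
(* The index (m, k, rows) presents an m by k matrix by the list of its rows. *)
pose rho (i : I) (s t : seq M) := [/\ T _ _ (mx i), size s = i.1.1, size t = i.1.2 &
  exists d, (forall j, D (d j)) /\
    system_solution (mx i) (fun j => nth 0 s j + d j) (fun l => nth 0 t l)].
have Imu : injects I mu.
  apply: prod_injects => //; first by apply: prod_injects.
  apply: injects_of_seq => //; apply: injects_seq.
  apply: injects_of_seq => //; exact: injects_seq.
apply: skolem_sub (@skolem_reflects mu M I rho Imu) => C refl m k a b Ta Cb [x [d [Dd ax]]].
pose rows := [seq [seq (a i j : R) | j <- enum 'I_k] | i <- enum 'I_m].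
have mxE : mx (m, k, rows) = a.
  apply/funext => i; apply/funext => j; rewrite /mx /rows /=.
  rewrite (nth_map i) ?size_enum_ord// nth_ord_enum (nth_map j) ?size_enum_ord//.
  by rewrite nth_ord_enum.
have nthE n (f : 'I_n -> M) (i : 'I_n) : nth 0 [seq f i | i <- enum 'I_n] i = f i.
  by rewrite (nth_map i) ?size_enum_ord// nth_ord_enum.
have [||t tC [_ _ st [e [De ae]]]] := refl (m, k, rows) [seq b i | i <- enum 'I_m].
- rewrite /within all_map; apply/allP => i _; exact/mem_set/Cb.
- exists [seq x j | j <- enum 'I_k]; split; rewrite ?mxE ?size_map -?enumT ?size_enum_ord//.
  by exists d; split=> // i; rewrite nthE -ax; apply: eq_bigr => j _; rewrite nthE.
exists (fun l => nth 0 t l), e; split=> // [j|i].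
  by apply/set_mem/(all_nthP 0 tC); rewrite st.
by rewrite -[b i]nthE -ae mxE.
Qed.

End Purity.

(** * Small extensions inside a class with clean hulls *)

Section CleanHulls.
Variables (R : pzRingType) (mu : Type) (K : module_class R) (T : system_class R).
Hypotheses (mu_inf : injects nat mu) (R_mu : injects R mu).
Hypothesis K_ext : forall (A B C : rmod R) (f : {linear A -> B}) (g : {linear B -> C}),
  short_exact f g -> K A -> K C -> K B.
Hypothesis K_hull : forall M : rmod R, K M -> exists Z : Type,
  skolem mu (fun C : set (M + Z) => clean_submodule K (inl @^-1` C)).

(** The bound on the cardinal LS: hulls of submodules are small, clean and pure. *)
Lemma small_pure_cover (A B : rmod R) (i : {linear A -> B}) :
  injective i -> K B -> exists (A' : rmod R) (j : {linear A' -> B}),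
    [/\ K A', injective j, pure_for T (range j), range i `<=` range j
      & injects A' (A + mu)].
Proof.
move=> iI /K_hull[Z hZ].
have inlI : injective (@inl B Z) by move=> x y [].
have := skolem_and mu_inf hZ
  (skolem_preimage inlI (skolem_pure_over T [set 0] mu_inf R_mu)).
move=> /(@skolem_hull mu mu_inf _ _ (inl @` range i))[C [[subC subK subQ] pC] [iC Csize]].
have [A' [j [jI jE]]] := submodule_incl subC.
have sub0 : submodule [set 0 : B].
  by split=> // r x y /= -> ->; rewrite scaler0 addr0.
exists A', j; split=> //; first exact: subK jE.
- have -> : range j = [set x + y | x in [set 0 : B] & y in inl @^-1` C].
    rewrite jE; apply/seteqP; split=> [x Cx|_ [_ -> [y Cy <-]]]; last by rewrite add0r.
    by exists 0 => //; exists x; rewrite ?add0r.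
  apply: pure_over_sum => //.
  move=> m k a b _ b0 _; exists (fun=> 0) => // r.
  by rewrite big1 ?(b0 r)// => l _; rewrite scaler0.
- by rewrite jE => x ix; apply: iC; exists x.
- apply: (@injects_trans _ {x | C x}).
    apply: (@injects_rel _ _ (fun x y => inl (j x) = sval y)).
      move=> x; have Cx : C (inl (j x)).
        by rewrite -[C _]/((inl @^-1` C) (j x)) -jE; exists x.
      by exists (exist _ _ Cx).
    by move=> x x' y e; rewrite -e => -[/jI->].
  apply: injects_trans Csize _; apply: injects_sum; last by exists id.
  apply: (@injects_rel _ _ (fun x a => sval x = inl (i a))).
    by move=> [x xi] /=; have [_ [a _ <-] <-] := xi; exists a.
  by move=> x x' y e e'; apply: sval_inj; rewrite e e'.
Qed.

(** Close b at once under the Skolem conditions that give clean submodules of A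
    and of N, and under those that make the trace CA on A equal to the inverse
    image of the trace CN on N. Then range i + CN is an extension of CN by a
    quotient isomorphic to A / CA, so that it belongs to K although A is
    arbitrarily large and N / A need not be in K. *)
Lemma small_generation (A N : rmod R) (i : {linear A -> N}) (b : N) :
  K A -> K N -> injective i -> pure_for T (range i) ->
  exists C : set N, [/\ submodule C, C b, injects {x | C x} mu,
    pure_for T [set x + y | x in range i & y in C]
  & forall (N' : rmod R) (j : {linear N' -> N}), injective j ->
      range j = [set x + y | x in range i & y in C] -> K N'].
Proof.
move=> /K_hull[Z hZ] /K_hull[W hW] iI pi.
pose X := ((A + Z) + (N + W))%type.
have inlI : injective (inl : A + Z -> X) by move=> x y [].
have inrI : injective (inr : N + W -> X) by move=> x y [].
have inrlI : injective (fun y : N => inr (inl y) : X) by move=> x y [].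
have c1 := skolem_preimage inlI hZ.
have c2 := skolem_preimage inrI hW.
have c3 := skolem_preimage inrlI (skolem_pure_over T (range i) mu_inf R_mu).
have c4 := @skolem_closed1 mu mu_inf X (fun x => match x with
  | inl (inl a) => [:: inr (inl (i a))] | _ => [::] end).
have c5 := @skolem_witness mu mu_inf X
  (fun x y => exists2 a, inr (inl (i a)) = x & inl (inl a) = y).
have := skolem_and mu_inf (skolem_and mu_inf c1 c2)
  (skolem_and mu_inf c3 (skolem_and mu_inf c4 c5)).
move=> /(@skolem_hull mu mu_inf _ _ [set inr (inl b)]).
move=> [C [[[subA _ subAQ] [subN subNK _]] [pC [AN NA]]] [bC Csize]].
set CA := inl @^-1` (inl @^-1` C) in subA subAQ.
set CN := inl @^-1` (inr @^-1` C) in subN subNK.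
have iCA a : CA a -> CN (i a).
  by move=> Ca; have := AN _ Ca; rewrite /within /= andbT => /set_mem.
have iCN a : CN (i a) -> CA a.
  move=> Ca; have [|z Cz [a' [e] e']] := NA _ (inl (inl a)) Ca; first by exists a.
  by rewrite -(iI _ _ e) /CA /preimage /= e'.
exists CN; split=> //.
- exact: bC.
- apply: (@injects_trans _ {x | C x}).
    exists (fun x => exist C (inr (inl (sval x))) (svalP x)) => x y.
    by move=> /(congr1 sval)/= [/sval_inj].
  apply: injects_trans Csize _; apply: sum_injects => //; last by exists id.
  have [g _] := mu_inf; exists (fun=> g 0%N) => -[x xb] [y yb] _.
  by apply: sval_inj; rewrite /= xb yb.
- by apply: pure_over_sum => //; exact: range_submodule.
move=> N' j jI jE.
have [N0 [j0 [j0I j0E]]] := submodule_incl subN.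
have [Q [q [qS qE]]] := quotient_proj subA.
have [|f fP] := @lift_linear _ N' N0 N j j0 jI.
  move=> x; rewrite jE; exists 0; first by exists 0; rewrite ?linear0.
  by exists (j0 x); rewrite ?add0r// -j0E; exists x.
(* The projection range i + CN -> A / CA, with kernel CN. *)
pose G (y : N') (z : Q) := exists a c, [/\ CN c, j y = i a + c & z = q a].
have Gfun y z z' : G y z -> G y z' -> z = z'.
  move=> [a [c [Cc yE ->]]] [a' [c' [Cc' yE' ->]]].
  apply/eqP; rewrite -subr_eq0 -linearB; apply/eqP.
  have : CA (a - a'); last by rewrite -qE.
  apply: iCN; rewrite linearB.
  have -> : i a - i a' = c' - c.
    by apply/eqP; rewrite subr_eq addrAC -subr_eq opprK -yE addrC yE'.
  exact: submoduleB.
have [||g gG] := @linear_of_graph _ N' Q G _ Gfun.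
- move=> y; have : range j (j y) by exists y.
  by rewrite jE => -[_ [a _ <-] [c Cc e]]; exists (q a), a, c.
- move=> r y y' z z' [a [c [Cc yE ->]]] [a' [c' [Cc' yE' ->]]].
  exists (r *: a + a'), (r *: c + c'); split; rewrite ?linearP//; first exact: subN.2.
  by rewrite yE yE' scalerDr addrACA.
apply: (K_ext (f := f) (g := g)); last by exact: subAQ qE.
  split.
  - by move=> x y /(congr1 j); rewrite !fP => /j0I.
  - apply/seteqP; split=> // z _; have [a _ <-] : range q z by rewrite qS.
    have [y _ jy] : range j (i a).
      rewrite jE; exists (i a); first by exists a.
      by exists 0; rewrite ?addr0//; exact: subN.1.
    exists y => //; apply: Gfun (gG y) _; exists a, 0.
    by split; [exact: subN.1|rewrite addr0|].
  - apply/seteqP; split=> [_ [x _ <-]|y gy].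
      apply: Gfun (gG _) _; exists 0, (j0 x).
      by split; rewrite ?linear0 ?add0r ?fP// -j0E; exists x.
    have [a [c [Cc yE qa]]] := gG y.
    have Ca : CA a by rewrite -qE /kernel /= -qa.
    have [x _ jx] : range j0 (j y).
      by rewrite j0E yE; apply: submoduleD => //; exact: iCA.
    by exists x => //; apply: jI; rewrite fP.
exact: subNK j0E.
Qed.

End CleanHulls.

(** * Coding the extensions generated by few elements *)

Section Codes.
Variables (R : pzRingType) (mu : Type) (A : rmod R) (h : A -> set mu).
Hypothesis hI : injective h.

Definition combination (N : rmod R) (nu : mu -> N) (s : seq (R * mu)) : N :=
  \sum_(p <- s) (p.1 : R^c) *: nu p.2.

(** A subset of this index set records an enumeration nu : mu -> N of a submodule C
    relative to A: which formal combinations of the nu m have their value in A,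
    and which value, an element of A being known through the subset h a of mu.
    The last summand records which nu m are equal to b. *)
Definition code_index : Type := (seq (R * mu) * option mu + mu)%type.

Definition code (N : rmod R) (i : {linear A -> N}) (nu : mu -> N) (b : N) :
    set code_index :=
  fun x => match x with
  | inl (s, None) => exists a, i a = combination nu s
  | inl (s, Some m) => exists a, i a = combination nu s /\ h a m
  | inr m => nu m = b end.

Lemma combination_cat (N : rmod R) (nu : mu -> N) s t :
  combination nu (s ++ t) = combination nu s + combination nu t.
Proof. exact: big_cat. Qed.

Lemma combination_scale (N : rmod R) (nu : mu -> N) (r : R^c) s :
  combination nu [seq ((r * (p.1 : R^c) : R^c) : R, p.2) | p <- s] = r *: combination nu s.
Proof.
by rewrite /combination big_map scaler_sumr; apply: eq_bigr => p _; rewrite scalerA.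
Qed.

Lemma combination1 (N : rmod R) (nu : mu -> N) (m : mu) :
  combination nu [:: (1, m)] = nu m.
Proof. by rewrite /combination big_seq1 /= scale1r. Qed.

Section Compare.
Variables (N1 N2 : rmod R) (i1 : {linear A -> N1}) (i2 : {linear A -> N2}).
Variables (nu1 : mu -> N1) (nu2 : mu -> N2) (b1 : N1) (b2 : N2).
Hypotheses (i1I : injective i1) (i2I : injective i2).
Hypothesis same : code i1 nu1 b1 = code i2 nu2 b2.

(** The relation i a + combination nu s = 0 says that the combination has the
    value - a in A, which the code records. *)
Lemma code_relation a s :
  i1 a + combination nu1 s = 0 -> i2 a + combination nu2 s = 0.
Proof.
move=> /eqP; rewrite addrC addr_eq0 -linearN => /eqP e.
have [a2 a2E] : code i2 nu2 b2 (inl (s, None)).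
  by rewrite -same; exists (- a).
suff ha : - a = a2 by rewrite -a2E -ha linearN addrN.
apply/hI/seteqP; split=> m.
  move=> hm; have : code i2 nu2 b2 (inl (s, Some m)) by rewrite -same; exists (- a).
  by move=> [a' [a'E]]; rewrite -a2E in a'E; rewrite -(i2I a'E).
move=> hm; have : code i1 nu1 b1 (inl (s, Some m)) by rewrite same; exists a2.
by move=> [a' [a'E]]; rewrite e in a'E; rewrite -(i1I a'E).
Qed.
End Compare.

(** The module range i + C is generated by A and the nu m, and the code determines
    the relations between these generators. *)
Lemma code_isomorphism (N1 N2 Q1 : rmod R) (i1 : {linear A -> N1})
    (i2 : {linear A -> N2}) (nu1 : mu -> N1) (nu2 : mu -> N2) (b1 : N1) (b2 : N2)
    (C1 : set N1) (C2 : set N2) (j1 : {linear Q1 -> N1}) :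
  injective i1 -> injective i2 -> code i1 nu1 b1 = code i2 nu2 b2 ->
  submodule C1 -> range nu1 = C1 -> submodule C2 -> range nu2 = C2 -> C1 b1 ->
  injective j1 -> range j1 = [set x + y | x in range i1 & y in C1] ->
  exists phi : {linear Q1 -> N2},
    [/\ injective phi, range phi = [set x + y | x in range i2 & y in C2],
        forall a q, j1 q = i1 a -> phi q = i2 a
      & forall q, j1 q = b1 -> phi q = b2].
Proof.
move=> i1I i2I same subC1 nu1C subC2 nu2C Cb1 j1I j1E.
have rel12 := code_relation i1I i2I same.
have rel21 := code_relation i2I i1I (esym same).
have combC s : C1 (combination nu1 s).
  by apply: submodule_sum => // p _; apply: submoduleZ => //; rewrite -nu1C; exists p.2.
have combC2 s : C2 (combination nu2 s).
  by apply: submodule_sum => // p _; apply: submoduleZ => //; rewrite -nu2C; exists p.2.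
pose G (q : Q1) (z : N2) := exists a s,
  j1 q = i1 a + combination nu1 s /\ z = i2 a + combination nu2 s.
have opp (N : rmod R) (nu : mu -> N) s : combination nu
    [seq ((-1 * (p.1 : R^c) : R^c) : R, p.2) | p <- s] = - combination nu s.
  by rewrite combination_scale scaleN1r.
have Gfun q z z' : G q z -> G q z' -> z = z'.
  move=> [a [s [e ->]]] [a' [s' [e' ->]]].
  have : i1 (a - a') + combination nu1
      (s ++ [seq ((-1 * (p.1 : R^c) : R^c) : R, p.2) | p <- s']) = 0.
    by rewrite linearB combination_cat opp addrACA -opprD -e -e' subrr.
  move=> /rel12/eqP; rewrite linearB combination_cat opp addrACA -opprD subr_eq0.
  by move=> /eqP.
have [||phi phiG] := @linear_of_graph _ Q1 N2 G _ Gfun.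
- move=> q; have : range j1 (j1 q) by exists q.
  rewrite j1E => -[_ [a _ <-] [c]]; rewrite -nu1C => -[m _ <-] e.
  by exists (i2 a + nu2 m), a, [:: (1, m)]; rewrite !combination1.
- move=> r q q' z z' [a [s [e ->]]] [a' [s' [e' ->]]].
  exists (r *: a + a'), ([seq ((r * (p.1 : R^c) : R^c) : R, p.2) | p <- s] ++ s').
  split; rewrite linearP combination_cat combination_scale ?linearP.
    by rewrite e e' scalerDr addrACA.
  by rewrite scalerDr addrACA.
exists phi; split.
- apply: raddf_inj => q /= phi0; have [a [s [e]]] := phiG q.
  by rewrite phi0 => /esym/rel21; rewrite -e -[RHS](linear0 j1) => /j1I.
- apply/seteqP; split=> [_ [q _ <-]|z [_ [a _ <-] [c]]].
    have [a [s [_ ->]]] := phiG q; exists (i2 a); first by exists a.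
    by exists (combination nu2 s).
  rewrite -nu2C => -[m _ <-] <-.
  have [q _ qE] : range j1 (i1 a + nu1 m).
    rewrite j1E; exists (i1 a); first by exists a.
    by exists (nu1 m); rewrite // -nu1C; exists m.
  by exists q => //; apply: Gfun (phiG q) _; exists a, [:: (1, m)]; rewrite !combination1.
- move=> a q qE; apply: Gfun (phiG q) _; exists a, [::].
  by rewrite /combination !big_nil !addr0.
- move=> q qE; have [m _ mE] : range nu1 b1 by rewrite nu1C.
  have : code i2 nu2 b2 (inr m) by rewrite -same.
  move=> /= mE2; apply: Gfun (phiG q) _; exists 0, [:: (1, m)].
  by rewrite !combination1 !linear0 !add0r mE mE2.
Qed.

End Codes.

(** * Counting Galois types *)

Section Stability.
Variables (R : pzRingType) (K : module_class R) (T : system_class R) (M : morphism_class R).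
Hypothesis M_T : forall (A B : rmod R) (f : {linear A -> B}),
  M f <-> injective f /\ pure_for T (range f).
Hypothesis K_ext : forall (A B C : rmod R) (f : {linear A -> B}) (g : {linear B -> C}),
  short_exact f g -> K A -> K C -> K B.
Hypothesis K_hull : forall mu : Type, injects nat mu -> injects R mu ->
  forall N : rmod R, K N -> exists Z : Type,
  skolem mu (fun C : set (N + Z) => clean_submodule K (inl @^-1` C)).

Lemma related_sym (I : Type) (A : rmod R) (t1 t2 : triple K I A) :
  atomically_related M t1 t2 -> atomically_related M t2 t1.
Proof.
move=> [N [f1 [f2 [e1 e2 eA eb]]]]; by exists N, f2, f1; split.
Qed.

Lemma related_gtp (I : Type) (A : rmod R) (t1 t2 t3 : triple K I A) :
  atomically_related M t1 t2 -> atomically_related M t2 t3 -> gtp M t1 = gtp M t3.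
Proof.
move=> t12 t23; apply/funext => t; apply/propext; split=> g.
  apply: Relation_Operators.t_trans g.
  apply: (Relation_Operators.t_trans _ _ _ t2);
    apply: Relation_Operators.t_step; exact: related_sym.
apply: Relation_Operators.t_trans g.
by apply: (Relation_Operators.t_trans _ _ _ t2); apply: Relation_Operators.t_step.
Qed.

(** A type has one code for each choice of C and of its enumeration nu; a code
    belongs to at most one type. *)
Definition coded (mu : Type) (A : rmod R) (h : A -> set mu) (t : triple K unit A)
    (E : set (code_index R mu)) : Prop :=
  exists (C : set (ambient t)) (nu : mu -> ambient t),
    [/\ submodule C, C (tup t tt), range nu = C,
        E = code h (Defs.incl t) nu (tup t tt)
      & pure_for T [set x + y | x in range (Defs.incl t) & y in C] /\
        forall (N : rmod R) (j : {linear N -> ambient t}), injective j ->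
        range j = [set x + y | x in range (Defs.incl t) & y in C] -> K N].

Lemma coded_ex (mu : Type) (A : rmod R) (h : A -> set mu) (t : triple K unit A) :
  injects nat mu -> injects R mu -> K_embedding K M (Defs.incl t) ->
  exists E, coded h t E.
Proof.
move=> mu_inf R_mu [KA KN /M_T[iI pi]].
have [C [subC Cb Csize pC KC]] :=
  small_generation mu_inf R_mu K_ext (K_hull mu_inf R_mu) (tup t tt) KA KN iI pi.
have [g gI] := Csize.
have /choice[nu nuP] : forall m, exists x, C x /\ forall c, g c = m -> x = sval c.
  move=> m; have [[c gc]|nc] := pselect (exists c, g c = m); last first.
    by exists (tup t tt); split=> // c gc; case: nc; exists c.
  by exists (sval c); split; [exact: (svalP c)|move=> c'; rewrite -gc => /gI->].
exists (code h (Defs.incl t) nu (tup t tt)), C, nu; split=> //.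
apply/seteqP; split=> [_ [m _ <-]|x Cx]; first by case: (nuP m).
by exists (g (exist _ x Cx)) => //; have [_ /(_ _ erefl)] := nuP (g (exist _ x Cx)).
Qed.

Lemma id_K_embedding (N : rmod R) : K N -> K_embedding K M (idfun : {linear N -> N}).
Proof.
move=> KN; split=> //; apply/M_T; split=> //.
by move=> m k a b _ _ [x ax]; exists x => // j; exists (x j).
Qed.

(** With Q1 the extension of A generated by C1, the triple (b, A, Q1) is related
    to t1 by the inclusion of Q1, and to t2 by the embedding of Q1 onto the
    extension generated by C2. No amalgam of t1 and t2 is needed. *)
Lemma coded_gtp (mu : Type) (A : rmod R) (h : A -> set mu) (t1 t2 : triple K unit A) E :
  injective h -> coded h t1 E -> coded h t2 E -> gtp M t1 = gtp M t2.
Proof.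
move=> hI [C1 [nu1 [subC1 Cb1 nuC1 -> [p1 K1]]]] [C2 [nu2 [subC2 Cb2 nuC2 same [p2 K2]]]].
have [Q1 [j1 [j1I j1E]]] :
    exists (Q : rmod R) (j : {linear Q -> ambient t1}),
      injective j /\ range j = [set x + y | x in range (Defs.incl t1) & y in C1].
  apply: submodule_incl; split.
    exists 0; first by exists 0; rewrite ?linear0.
    by exists 0; rewrite ?addr0//; exact: subC1.1.
  move=> r _ _ [_ [a _ <-] [c Cc <-]] [_ [a' _ <-] [c' Cc' <-]].
  exists (Defs.incl t1 (r *: a + a')); first by exists (r *: a + a').
  exists (r *: c + c'); first exact: subC1.2.
  by rewrite linearP scalerDr addrACA.
have KQ := K1 _ _ j1I j1E.
have [phi [phiI phiE phiA phib]] := code_isomorphism hI (@incl_inj _ _ _ _ t1)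
  (@incl_inj _ _ _ _ t2) same subC1 nuC1 subC2 nuC2 Cb1 j1I j1E.
have [|i1 i1P] := @lift_linear _ Q1 A _ j1 (Defs.incl t1) j1I.
  move=> a; rewrite j1E; exists (Defs.incl t1 a); first by exists a.
  by exists 0; rewrite ?addr0//; exact: subC1.1.
have i1I : injective i1.
  by move=> x y /(congr1 j1); rewrite !i1P => /(@incl_inj _ _ _ _ t1).
have [b _ bE] : range j1 (tup t1 tt).
  rewrite j1E; exists 0; first by exists 0; rewrite ?linear0.
  by exists (tup t1 tt); rewrite ?add0r.
pose q : triple K unit A := Triple KQ i1I (fun _ : unit => b).
apply: (related_gtp (t2 := q)).
  exists (ambient t1), idfun, j1; split=> //.
  - by apply: id_K_embedding; exact: ambient_in.
  - by split=> //; [exact: ambient_in|apply/M_T; rewrite j1E].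
  - by case; rewrite /= bE.
exists (ambient t2), phi, idfun; split=> //.
- by split=> //; [exact: ambient_in|apply/M_T; rewrite phiE].
- by apply: id_K_embedding; exact: ambient_in.
- by move=> a /=; apply: phiA; rewrite i1P.
- by case=> /=; exact: phib.
Qed.

(** LS is card R + aleph_0, and K is stable in 2 ^ LS, since every type over a
    module of this size has a code among the subsets of a set of size LS. *)
Lemma class_stable : stable K M.
Proof.
pose mu := (R + nat)%type.
have mu_inf : injects nat mu by exists inr => x y [].
have R_mu : injects R mu by exists inl => x y [].
exists mu, (set mu); split.
- split=> [|l' [l'inf Rl' _]].
    split.
    + exact/infiniteP/card_leTP.
    + exact/card_leTP.
    + move=> A B i iI KB.
      have [A' [j [KA' jI pj ij A'size]]] :=
        small_pure_cover T mu_inf R_mu (K_hull mu_inf R_mu) iI KB.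
      exists A', j; split=> //; last exact/card_leTP.
      by split=> //; exact/M_T.
  have {}l'inf : injects nat l' by exact/card_leTP/infiniteP.
  by apply/card_leTP/sum_injects => //; exact/card_leTP.
- by apply/card_leTP; exists set1 => x y /seteqP[/(_ x erefl)].
- move=> A KA; rewrite card_eq_le => /andP[/card_leTP[h hI] _].
  have iT : injects (code_index R mu) mu.
    apply: sum_injects => //; last by exists id.
    apply: prod_injects => //.
      apply: injects_of_seq => //; apply: injects_seq.
      by apply: prod_injects => //; exists id.
    apply: (@injects_trans _ (seq mu)); last exact: seq_injects.
    by exists (fun o => if o is Some m then [:: m] else [::]) => -[x|] [y|] // [->].
  have [k kI] := iT.
  have /choice[E EP] : forall p : {p | @gS R K M A p}, exists E,
      exists2 t : triple K unit A, coded h t E & sval p = gtp M t.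
    move=> [p [t it pE]]; have [E tE] := coded_ex h mu_inf R_mu it.
    by exists E, t.
  exists (fun p => k @` E p) => p p' e.
  have {}e : E p = E p'.
    apply/seteqP; split=> x Ex.
      have : (k @` E p') (k x) by [rewrite -e; exists x].
      by move=> [y Ey /kI <-].
    have : (k @` E p) (k x) by [rewrite e; exists x].
    by move=> [y Ey /kI <-].
  have [t tE pt] := EP p; have [t' tE' pt'] := EP p'.
  apply: sval_inj; rewrite pt pt'; rewrite e in tE.
  exact: coded_gtp hI tE tE'.
Qed.

End Stability.

Theorem corollary3p20 (R : pzRingType) (n : nat) (M : morphism_class R) :
  M = @embedding R \/ M = @RD_embedding R \/ M = @pure_embedding R ->
  stable (@free_class R) M /\ stable (@proj_dim_le R n) M.
Proof.
move=> /embedding_classes[T M_T].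
have stab b k (K : module_class R) : (forall N, K N <-> pd_class b k N) -> stable K M.
  move=> KE; apply: (class_stable M_T).
    move=> A B C f g fg /KE KA /KE KC; apply/KE; exact: pd_extension fg KA KC.
  move=> mu mu_inf R_mu N /KE/(pd_hull mu_inf R_mu)[Z hZ]; exists Z.
  apply: skolem_sub hZ => C [subC subK subQ]; split=> // [A j jI jE|Q q qS qE]; apply/KE.
    exact: subK jE.
  exact: subQ qE.
split.
  by apply: (stab true 0%N) => N; split=> [/free_coord|/coord_free].
by apply: (stab false n) => N; split=> [/pd_of_resolution|/resolution_of_pd].
Qed.
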